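(* There are no pull-back transformations of a hypergeometric equation with the local exponent differences $(1/2,1/3,1/6)$ (in some order) to a hypergeometric equation with the local exponent differences $(1/3,1/3,1/3)$ whose covering has degree $6n+4$, for any integer $n\ge 0$.
   Context: Euler's hypergeometric equation with parameters $A,B,C$ is $z(1-z)y''+(C-(A+B+1)z)y'-AB\,y=0$; its singular points are $0,1,\infty$ with local exponent differences (taken up to sign) $1-C$, $C-A-B$, $A-B$ respectively. A pull-back transformation of a hypergeometric equation $\mathcal{E}$ to a hypergeometric equation $\mathcal{E}'$ is a substitution $y(z)\mapsto\theta(x)\,y(\varphi(x))$ which transforms solutions of $\mathcal{E}$ (in $z$) to solutions of $\mathcal{E}'$ (in $x$), where $\varphi$ is a non-constant rational function (the covering) and $\theta$ is a radical function, i.e. a product of powers of rational functions. The degree of the transformation is the degree of $\varphi$ as a map $\mathbb{P}^1\to\mathbb{P}^1$. *)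

(* Defs.v *)
From mathcomp Require Import all_boot all_order all_algebra.
From mathcomp Require Import complex.
From mathcomp Require Import all_classical all_reals all_analysis.

Set Implicit Arguments.
Unset Strict Implicit.
Unset Printing Implicit Defensive.

Import Order.TTheory GRing.Theory Num.Theory.
Import numFieldNormedType.Exports.

Local Open Scope classical_set_scope.
Local Open Scope ring_scope.
Local Open Scope complex_scope.

(* [R[i]^o] is R[i] as a normed module over itself: [derivable f z 1] and
   [derive1 f z] for [f : R[i]^o -> R[i]^o] are complex differentiability and the
   complex derivative. *)

Definition cexp (R : realType) (z : R[i]^o) : R[i]^o :=
  (expR (complex.Re z))%:C * (cos (complex.Im z) +i* sin (complex.Im z)).

Record ratfun (R : realType) := RatFun {
  rnum : {poly R[i]};
  rden : {poly R[i]};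
  rden_neq0 : rden != 0;
  rnum_rden_coprime : coprimep rnum rden }.

(* Meaningful only where [rden f] does not vanish; every use below is guarded
   by that condition. *)
Definition reval (R : realType) (f : ratfun R) (x : R[i]^o) : R[i]^o :=
  (rnum f).[x] / (rden f).[x].

(* The degree as a self-map of P^1; it is 0 exactly when f is constant. *)
Definition rdeg (R : realType) (f : ratfun R) : nat :=
  (maxn (size (rnum f)) (size (rden f))).-1.

(* z(1-z) y'' + (C - (A+B+1) z) y' - A B y = 0 *)
Record hypergeom (R : realType) := Hypergeom {
  parA : R[i];
  parB : R[i];
  parC : R[i] }.

(* At 0, 1 and oo, in this order; each is defined up to sign only. *)
Definition exp_diffs (R : realType) (E : hypergeom R) : seq R[i] :=
  [:: 1 - parC E; parC E - parA E - parB E; parA E - parB E].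

(* Equality with s up to the order of the singular points and up to signs. *)
Definition has_exp_diffs (R : realType) (E : hypergeom R) (s : seq R[i]) :=
  exists2 t : seq R[i], perm_eq t s &
    all2 (fun d e => (d == e) || (d == - e)) (exp_diffs E) t.

(* y is a holomorphic solution of E on the open set U; U need not be connected,
   and the values of y outside U are irrelevant. *)
Definition solution (R : realType) (E : hypergeom R) (U : set R[i]^o)
    (y : R[i]^o -> R[i]^o) : Prop :=
  open U /\
  forall z, U z ->
    [/\ derivable y z 1,
        derivable (derive1 y) z 1 &
        z * (1 - z) * derive1 (derive1 y) z
          + (parC E - (parA E + parB E + 1) * z) * derive1 y z
          - parA E * parB E * y z = 0].

(* The formal product of the powers [rad_base i] ^ [rad_expo i]. *)
Record radical (R : realType) := Radical {
  rad_size : nat;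
  rad_base : 'I_rad_size -> ratfun R;
  rad_expo : 'I_rad_size -> R[i];
  rad_base_neq0 : forall i, rnum (rad_base i) != 0 }.

Arguments rad_base {R} r i.
Arguments rad_expo {R} r i.

Definition log_branch (R : realType) (r : ratfun R) (U : set R[i]^o)
    (l : R[i]^o -> R[i]^o) : Prop :=
  forall x, U x ->
    [/\ (rden r).[x] != 0, derivable l x 1 & cexp (l x) = reval r x].

(* A radical function is multivalued: its branches on U come from the branches
   r ^ c = exp (c log r) of its factors. *)
Definition radical_branch (R : realType) (theta : radical R) (U : set R[i]^o)
    (t : R[i]^o -> R[i]^o) : Prop :=
  exists2 l : 'I_(rad_size theta) -> R[i]^o -> R[i]^o,
    forall i, log_branch (rad_base theta i) U (l i) &
    forall x, U x ->
      t x = \prod_(i < rad_size theta) cexp (rad_expo theta i * l i x).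

(* The substitution y(z) |-> theta(x) y(phi(x)) sends local solutions of E to
   local solutions of E', for all branches of theta. *)
Definition pullback (R : realType) (E E' : hypergeom R) (phi : ratfun R)
    (theta : radical R) : Prop :=
  (0 < rdeg phi)%N /\
  forall (V : set R[i]^o) (y : R[i]^o -> R[i]^o)
         (U : set R[i]^o) (t : R[i]^o -> R[i]^o),
    solution E V y ->
    open U ->
    (forall x, U x -> (rden phi).[x] != 0 /\ V (reval phi x)) ->
    radical_branch theta U t ->
    solution E' U (fun x => t x * y (reval phi x)).

(* Main.v *)
Require Import Defs.
From mathcomp Require Import all_boot all_order all_algebra.
From mathcomp Require Import complex.
From mathcomp Require Import all_classical all_reals all_analysis.
From mathcomp Require Import ring lra zify.

(** Write the covering as [P / Q], a map of degree [6 n + 4], and let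
[W = P' Q - P Q'].

Both equations are of Euclidean type: their exponent differences [d0], [d1],
[d2] add up to 1 for suitable signs. Such an equation has an elementary
solution [z^al (1 - z)^be] with [al] in [{0, - d0}] and [be] in [{0, - d1}], and
any other solution is this one times a primitive of
[z^(d0 - 1) (1 - z)^(d1 - 1)]. A pull-back has to match these two differentials
up to a constant factor. With [m0 = 6 d0] and [m1 = 6 d1], the sixth power of
this relation is the polynomial identity of [covering_identity],
[[
  W^6 (x (1 - x))^4 = k P^(6 - m0) (Q - P)^(6 - m1) Q^(m0 + m1).
]]
It determines all multiplicities in the three fibres. The fibres over the points
with differences 1/2 and 1/6 are squares [a^2] and [b^2]; the fibre over the
point with difference 1/3 has multiplicity 3, except for simple points, which
lie in [{0, 1, oo}]. The third fibre is a linear combination of [a^2] and [b^2],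
so it splits into two coprime forms of degree [3 n + 2]. Modulo 3, the degree of
each of them is its number of simple points, so each needs at least two simple
points; but only three points are available. This is [no_elliptic_covering],
where the point at infinity shows up as a drop of the degree.

The identity is obtained as follows. Frobenius' method at the origin gives two
independent solutions of the first equation ([fundamental_pair]). Pulled back by
a local branch of the radical factor [theta] ([branch_exists]), both of them
satisfy the second equation, so the coefficients of [y] and of [y'] in the
transformed equation vanish separately ([pullback_ode_at]); these are two
relations between rational functions involving [u = theta' / theta], valid at
infinitely many points. Let [t] be the logarithmic derivative of the pulled-back
elementary solution minus that of the elementary solution of the second
equation. It is rational, and the difference of two Riccati equations gives
[t' + t^2 + (2/3) (1/x - 1/(1 - x)) t = 0], which has no nonzero rational
solution ([no_rational_solution]). With [t = 0], the coefficient of [y'] becomes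
the equality of the logarithmic derivatives of the two sides of the identity. *)

Set Implicit Arguments.
Unset Strict Implicit.
Unset Printing Implicit Defensive.

Import Order.TTheory GRing.Theory Num.Theory.
Import numFieldNormedType.Exports.
Import ComplexField.Normc.

Local Open Scope ring_scope.

(** * Polynomials with prescribed root multiplicities *)

Section Endgame.
Variable C : numClosedFieldType.
Implicit Types (p q F G : {poly C}) (a : C).

Definition wronsk F G := F^`() * G - F * G^`().

Lemma mup_factor a p : p != 0 ->
  exists2 q, ~~ root q a & p = q * ('X - a%:P) ^+ mup a p.
Proof.
move=> p0; have [m [q qa pE]] := multiplicity_XsubC p a.
move: qa; rewrite p0 /= => qa.
exists q => //; suff -> : mup a p = m by [].
by rewrite pE mupMr // mup_XsubCX eqxx.
Qed.

Lemma mup_exp a p k : p != 0 -> mup a (p ^+ k) = (k * mup a p)%N.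
Proof.
move=> p0; elim: k => [|k IH]; first by rewrite expr0 mupNroot // root1.
by rewrite exprS mupM ?expf_neq0 // IH mulSn.
Qed.

(** In characteristic 0 the derivative lowers the order of vanishing of [F] by
exactly one, and [G] does not vanish at [a]. *)
Lemma mup_wronsk a F G : coprimep F G -> F != 0 -> root F a ->
  wronsk F G != 0 -> (mup a (wronsk F G)).+1 = mup a F.
Proof.
move=> cFG F0 Fa W0.
have Ga : ~~ root G a by exact: (coprimep_root cFG Fa).
have [f fa FE] := mup_factor a F0.
have : (0 < mup a F)%N by rewrite -XsubC_dvd // dvdp_XsubCl.
move: FE; case: (mup a F) => // e FE _; congr _.+1.
have -> : wronsk F G = ((f * G) *+ e.+1 + ('X - a%:P) * wronsk f G) * ('X - a%:P) ^+ e.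
  rewrite /wronsk FE derivM deriv_exp derivB derivX derivC subr0 mul1r /= exprS.
  ring.
rewrite mupMr ?mup_XsubCX ?eqxx //.
rewrite rootE hornerD hornerMn !hornerM hornerXsubC subrr mul0r addr0.
by rewrite mulrn_eq0 /= mulf_neq0.
Qed.

Definition X01 : {poly C} := 'X * (1 - 'X).

Lemma mup_X01 a : mup a X01 = ((a == 0) || (a == 1)) :> nat.
Proof.
have -> : X01 = - ('X - 0%:P) ^+ 1 * ('X - 1%:P) ^+ 1 :> {poly C} by rewrite /X01; ring.
have e0 : ('X - 0%:P : {poly C}) ^+ 1 != 0 by rewrite expf_neq0 // polyXsubC_eq0.
have e1 : ('X - 1%:P : {poly C}) ^+ 1 != 0 by rewrite expf_neq0 // polyXsubC_eq0.
rewrite -[- _]mulN1r -mulrA mupMr; last first.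
  by rewrite rootE hornerN hornerC oppr_eq0 oner_eq0.
rewrite mupM // !mup_XsubCX (eq_sym 0) (eq_sym 1).
by have [->|_] := eqVneq a 0; rewrite 1?eq_sym ?oner_eq0 //=; case: eqP.
Qed.

Lemma even_mup_sqr p : (forall a, ~~ odd (mup a p)) -> exists q, p = q ^+ 2.
Proof.
have [k] := ubnP (size p); elim: k p => // k IH p pk ev.
have [/size1_polyC ->|p1] := leqP (size p) 1.
  by exists (sqrtC (p`_0))%:P; rewrite -polyC_exp sqrtCK.
have p0 : p != 0 by rewrite -size_poly_gt0 (ltn_trans _ p1).
have /closed_rootP [a pa] : size p != 1 by rewrite gtn_eqF.
have [q qa pE] := mup_factor a p0.
have q0 : q != 0 by apply: contra qa => /eqP ->; rewrite root0.
have m0 : (0 < mup a p)%N by rewrite -XsubC_dvd // dvdp_XsubCl.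
have [|b|r qE] := IH q.
- by move: pk m0; rewrite pE size_Mmonic ?monic_exp ?monicXsubC // size_exp_XsubC addnS /= -pE; case: (mup a p) => // m; rewrite addnS ltnS => qm _; apply: leq_trans qm; rewrite ltnS leq_addr.
- have [<-|ab] := eqVneq a b; first by rewrite mupNroot.
  by have := ev b; rewrite pE mupM ?expf_neq0 ?polyXsubC_eq0 // mup_XsubCX (negPf ab) addn0.
exists (r * ('X - a%:P) ^+ (mup a p)./2).
by rewrite {1}pE exprMn -qE -exprM muln2 -[in LHS](odd_double_half (mup a p)) (negPf (ev a)).
Qed.

(** Triple roots do not matter modulo 3, and the only other roots are simple. *)
Lemma size_mod3 p : p != 0 ->
  (forall a, root p a -> if (a == 0) || (a == 1) then mup a p = 1%N else mup a p = 3%N) ->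
  ((size p).-1 = root p 0%R + root p 1%R %[mod 3])%N.
Proof.
have [k] := ubnP (size p); elim: k p => // k IH p pk p0 ev.
have [/size1_polyC pE|p1] := leqP (size p) 1.
  have c0 : p`_0 != 0 by apply: contra p0; rewrite {2}pE => /eqP ->.
  by rewrite pE size_polyC !rootC (negPf c0).
have /closed_rootP [a pa] : size p != 1 by rewrite gtn_eqF.
have [q qa pE] := mup_factor a p0.
have q0 : q != 0 by apply: contra qa => /eqP ->; rewrite root0.
have m0 : (0 < mup a p)%N by rewrite -XsubC_dvd // dvdp_XsubCl.
have mb b : a != b -> mup b p = mup b q.
  by move=> ab; rewrite [in LHS]pE mupM ?expf_neq0 ?polyXsubC_eq0 // mup_XsubCX (negPf ab) addn0.
have rb b : a != b -> root p b = root q b.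
  by move=> ab; rewrite -!dvdp_XsubCl !XsubC_dvd // mb.
have sp : size p = (size q + mup a p)%N.
  by rewrite [in LHS]pE size_Mmonic ?monic_exp ?monicXsubC // size_exp_XsubC addnS.
have sq : (0 < size q)%N by rewrite size_poly_gt0.
have := IH q; rewrite q0 => /(_ _ isT) IHq.
have {}IHq : ((size q).-1 = root q 0%R + root q 1%R %[mod 3])%N.
  apply: IHq; first by lia.
  move=> b qb; have ab : a != b by apply: contraNneq qa => ->.
  by rewrite -mb //; apply: ev; rewrite rb.
have := ev a pa; have [a0|a0] /= := eqVneq a 0.
  have [p0a q0a] : root p 0 /\ ~~ root q 0 by rewrite -a0.
  rewrite sp p0a (rb 1) ?a0 1?eq_sym ?oner_eq0 // => ->.
  by move: IHq; rewrite (negPf q0a); move: (size q) sq (root q 1) => [|m] // _ b; rewrite addn1 /= add0n -(addn1 m) -(modnDml m) => ->; rewrite modnDml addnC.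
have [a1|a1] /= := eqVneq a 1.
  have [p1a q1a] : root p 1 /\ ~~ root q 1 by rewrite -a1.
  rewrite sp p1a (rb 0) ?a1 ?oner_eq0 // => ->.
  by move: IHq; rewrite (negPf q1a); move: (size q) sq (root q 0) => [|m] // _ b; rewrite addn1 /= addn0 -(addn1 m) -(modnDml m) => ->; rewrite modnDml.
move=> ma; rewrite sp ma !rb //; move: IHq; move: (size q) sq (root q 0) (root q 1) => [|m] // _ b c mE.
by rewrite addSn -pred_Sn modnDr.
Qed.

Lemma coef_top p q m n : (size p <= m.+1)%N -> (size q <= n.+1)%N ->
  (p * q)`_(m + n) = p`_m * q`_n.
Proof.
move=> pm qn; rewrite coefM (bigD1 (Ordinal (leq_addr n m : m < (m + n).+1)%N)) //= addKn.
rewrite big1 ?addr0 // => [[i /= im]]; rewrite -val_eqE /= => ne.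
have [lt|gt|eq] := ltngtP i m; last by rewrite eq eqxx in ne.
  by rewrite [q`__]nth_default ?mulr0 // (leq_trans qn) // ltn_subRL ltn_add2r.
by rewrite [p`__]nth_default ?mul0r // (leq_trans pm).
Qed.

(** Multiplied by ['X], both products have formal top degree [deg F + deg G], where
the coefficients differ by the factor [deg F - deg G]. *)
Lemma size_wronsk F G : F != 0 -> (size F < size G)%N ->
  (size (wronsk F G)).+2 = (size F + size G)%N.
Proof.
move=> F0 FG.
have G0 : G != 0 by rewrite -size_poly_gt0 (leq_trans _ FG).
have [f sF] : exists f, size F = f.+1 by exists (size F).-1; rewrite prednK ?size_poly_gt0.
have [g sG] : exists g, size G = g.+1 by exists (size G).-1; rewrite prednK ?size_poly_gt0.
have sd p m : size p = m.+1 -> (size ('X * p^`())%R <= m.+1)%N.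
  move=> pm; apply: leq_trans (size_polyMleq _ _) _.
  rewrite size_polyX /= -pm lt_size_deriv //.
  by rewrite -size_poly_gt0 pm.
have cd p m : ('X * p^`())`_m = p`_m *+ m.
  by rewrite coefXM; case: m => [|m] //=; rewrite coef_deriv.
have XW : 'X * wronsk F G = ('X * F^`()) * G - F * ('X * G^`()).
  by rewrite /wronsk; ring.
have c : ('X * wronsk F G)`_(f + g) = F`_f * G`_g * (f%:R - g%:R).
  rewrite XW coefB !coef_top ?sd ?sF ?sG // !cd -(mulr_natr (F`_f)) -(mulr_natr (G`_g)); ring.
have lF : F`_f != 0 by have := lead_coef_eq0 F; rewrite lead_coefE sF /= => ->.
have lG : G`_g != 0 by have := lead_coef_eq0 G; rewrite lead_coefE sG /= => ->.
have c0 : ('X * wronsk F G)`_(f + g) != 0.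
  by rewrite c !mulf_neq0 // subr_eq0 eqr_nat; move: FG; rewrite sF sG ltnS => /ltn_eqF ->.
have W0 : wronsk F G != 0 by apply: contraNneq c0 => ->; rewrite mulr0 coef0.
have : size ('X * wronsk F G) = (f + g).+1.
  apply/eqP; rewrite eqn_leq; apply/andP; split; last first.
    by rewrite ltnNge; apply: contra c0 => /leq_sizeP ->.
  rewrite XW (leq_trans (size_polyD _ _)) // size_polyN geq_max.
  apply/andP; split; apply: leq_trans (size_polyMleq _ _) _.
    by have := sd _ _ sF; rewrite sG addnS -pred_Sn -[(f + g).+1]addSn leq_add2r.
  by have := sd _ _ sG; rewrite sF addSn -pred_Sn -[(f + g).+1]addnS leq_add2l.
by rewrite mulrC size_mulX // sF sG addSn addnS => ->.
Qed.

(** [F2], [F3] and [F6] are the fibres over the points with exponent differences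
1/2, 1/3 and 1/6. Comparing orders of vanishing in the identity, a point of
multiplicity [e] in the fibre with difference [d] satisfies [e d = 1] away from
0 and 1, and [e d = 1/3] at 0 and 1. Hence [F2 = a^2] and [F6 = b^2], and the
degree of [F3] drops by at most one. So [F3 = g1 g2] with [g1] and [g2]
proportional to [r a - s b] and [r a + s b], and [size_mod3] applies to both. *)
Lemma no_elliptic_covering (F2 F3 F6 : {poly C}) k l c n :
  k != 0 -> l != 0 -> c != 0 ->
  F3 = k *: F2 + l *: F6 -> coprimep F2 F6 ->
  maxn (size F2) (size F6) = (6 * n + 5)%N ->
  wronsk F2 F6 ^+ 6 * X01 ^+ 4 = c *: (F2 ^+ 3 * F3 ^+ 4 * F6 ^+ 5) ->
  wronsk F2 F6 != 0 -> False.
Proof.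
move=> k0 l0 c0 F3E co sz K W0.
have w0 (F : {poly C}) : wronsk 0 F = 0 by rewrite /wronsk raddf0 !mul0r subr0.
have wr0 (F : {poly C}) : wronsk F 0 = 0 by rewrite /wronsk raddf0 !mulr0 subr0.
have F20 : F2 != 0 by apply: contraNneq W0 => ->; rewrite w0.
have F60 : F6 != 0 by apply: contraNneq W0 => ->; rewrite wr0.
have W3 : wronsk F3 F6 = k *: wronsk F2 F6.
  by rewrite /wronsk F3E derivD !derivZ -!mul_polyC; ring.
have W6 : wronsk F6 F2 = - wronsk F2 F6 by rewrite /wronsk; ring.
have F30 : F3 != 0.
  by apply: contraNneq W0 => F30; move: W3; rewrite F30 w0 => /esym/eqP; rewrite scaler_eq0 (negPf k0).
have co3 : coprimep F3 F6.
  by rewrite F3E -(mul_polyC l) addrC coprimep_sym coprimep_addl_mul coprimepZr // coprimep_sym.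
have X0 : X01 != 0.
  rewrite /X01 mulf_neq0 ?polyX_eq0 // -opprB oppr_eq0.
  by rewrite -[1]/(1%:P) polyXsubC_eq0.
have mK a : (6 * mup a (wronsk F2 F6) + 4 * ((a == 0%R) || (a == 1%R)) =
             3 * mup a F2 + 4 * mup a F3 + 5 * mup a F6)%N.
  have h (w x c' p q r : {poly C}) : w ^+ 6 * x ^+ 4 = c' * (p ^+ 3 * q ^+ 4 * r ^+ 5) ->
    [&& w != 0, x != 0, p != 0, q != 0 & r != 0] -> ~~ root c' a ->
    (6 * mup a w + 4 * mup a x = 3 * mup a p + 4 * mup a q + 5 * mup a r)%N.
    move=> e /and5P [hw hx hp hq hr] hc; have := congr1 (mup a) e.
    have nz (f : {poly C}) m : f != 0 -> f ^+ m != 0 by exact: expf_neq0.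
    rewrite (mupM a (nz w 6%N hw) (nz x 4%N hx)) (mupMr _ hc).
    rewrite (mupM a (mulf_neq0 (nz p 3%N hp) (nz q 4%N hq)) (nz r 5%N hr)).
    by rewrite (mupM a (nz p 3%N hp) (nz q 4%N hq)) !mup_exp.
  rewrite -mup_X01; apply: h (c%:P) _ _ _ _ _ _; rewrite ?mul_polyC // ?rootC //.
  by rewrite W0 X0 F20 F30 F60.
have r6 a : root F2 a -> mup a F6 = 0%N.
  by move=> Fa; rewrite mupNroot //; apply: coprimep_root Fa.
have r2 a : root F6 a -> mup a F2 = 0%N.
  by move=> Fa; rewrite mupNroot //; apply: coprimep_root Fa; rewrite coprimep_sym.
have r36 a : root F3 a -> mup a F6 = 0%N.
  by move=> Fa; rewrite mupNroot //; apply: coprimep_root Fa.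
have r3_26 a : root F2 a || root F6 a -> mup a F3 = 0%N.
  case/orP => ra; rewrite mupNroot //.
    by rewrite /root F3E !hornerE (eqP ra) mulr0 add0r mulf_neq0 //; apply: coprimep_root ra.
  by apply/negP => r3; have := coprimep_root co3 r3; rewrite (eqP ra) eqxx.
have W60 : wronsk F6 F2 != 0 by rewrite W6 oppr_eq0.
have W30 : wronsk F3 F6 != 0 by rewrite W3 scaler_eq0 negb_or k0.
have ev2 a : ~~ odd (mup a F2).
  have [ra|/mupNroot -> //] := boolP (root F2 a).
  have := mK a; rewrite -(mup_wronsk co _ ra W0) // (r6 _ ra) r3_26 ?ra //.
  by move: (mup a (wronsk F2 F6)) => e; case: (_ || _) => /= h; clear -h; lia.
have ev6 a : ~~ odd (mup a F6).
  have [ra|/mupNroot -> //] := boolP (root F6 a).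
  have := mK a; rewrite -(mup_wronsk _ _ ra W60) 1?coprimep_sym // (r2 _ ra) r3_26 ?ra ?orbT //.
  rewrite W6 -[- _]mulN1r mupMr; last by rewrite -(@rmorphN1 _ _ (@polyC C)) rootC oppr_eq0 oner_eq0.
  by move: (mup a (wronsk F2 F6)) => e; case: (_ || _) => /= h; clear -h; lia.
have m3 a : root F3 a -> if (a == 0) || (a == 1) then mup a F3 = 1%N else mup a F3 = 3%N.
  move=> ra; have := mK a; rewrite -(mup_wronsk co3 _ ra W30) // (r36 _ ra).
  have -> : mup a F2 = 0%N.
    by apply: mupNroot; apply/negP => r; have := mup_wronsk co3 F30 ra W30; rewrite r3_26 ?r.
  rewrite W3 -mul_polyC mupMr ?rootC //.
  by move: (mup a (wronsk F2 F6)) => e; case: (_ || _) => /= h; clear -h; lia.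
have s3 : size F3 = (6 * n + 5)%N \/ size F3 = (6 * n + 4)%N.
  have le3 : (size F3 <= 6 * n + 5)%N.
    by rewrite -sz F3E (leq_trans (size_polyD _ _)) // !size_scale.
  move: le3; rewrite leq_eqVlt => /orP [/eqP|lt3]; [by left|right].
  have [e2 e6] : size F2 = (6 * n + 5)%N /\ size F6 = (6 * n + 5)%N.
    move: sz lt3; rewrite F3E -(size_scale F2 k0) -(size_scale F6 l0) => <-.
    have [lt|lt|->] := ltngtP (size (k *: F2)) (size (l *: F6)); last by split.
      by rewrite [_ + l *: F6]addrC size_polyDl // ltnn.
    by rewrite size_polyDl // ltnn.
  have := size_wronsk F30 (_ : size F3 < size F6)%N; rewrite e6 => /(_ lt3).
  rewrite W3 size_scale //.
  have dM (p q : {poly C}) : p != 0 -> q != 0 -> ((size (p * q)%R).-1 = (size p).-1 + (size q).-1)%N.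
    move=> p0 q0; rewrite size_mul //; move: p0 q0; rewrite -!size_poly_gt0.
    by case: (size p) (size q) => [|a] // [|b] // _ _; rewrite addSn addnS.
  have h (w x p q r : {poly C}) : w ^+ 6 * x ^+ 4 = c *: (p ^+ 3 * q ^+ 4 * r ^+ 5) ->
    [&& w != 0, x != 0, p != 0, q != 0 & r != 0] ->
    ((size w).-1 * 6 + (size x).-1 * 4 = (size p).-1 * 3 + (size q).-1 * 4 + (size r).-1 * 5)%N.
    move=> e /and5P [hw hx hp hq hr].
    have := congr1 (fun p : {poly C} => (size p).-1) e; rewrite size_scale //.
    have nz (f : {poly C}) m : f != 0 -> f ^+ m != 0 by exact: expf_neq0.
    rewrite (dM _ _ (nz w 6%N hw) (nz x 4%N hx)).
    rewrite (dM _ _ (mulf_neq0 (nz p 3%N hp) (nz q 4%N hq)) (nz r 5%N hr)).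
    by rewrite (dM _ _ (nz p 3%N hp) (nz q 4%N hq)) !size_exp.
  have := h _ _ _ _ _ K; rewrite W0 X0 F20 F30 F60 => /(_ isT).
  have sX : size X01 = 3%N.
    rewrite /X01 mulrC size_mulX; last by rewrite -opprB oppr_eq0 -[1]/(1%:P) polyXsubC_eq0.
    by rewrite -opprB size_polyN -[1]/(1%:P) size_XsubC.
  rewrite sX e2 e6.
  have := size_poly_gt0 F3; rewrite F30.
  by move: (size F3) (size (wronsk F2 F6)); clear; lia.
have [a aE] := even_mup_sqr ev2.
have [b bE] := even_mup_sqr ev6.
pose r := sqrtC k; pose s := sqrtC (- l).
have r0 : r != 0 by rewrite sqrtC_eq0.
have s0 : s != 0 by rewrite sqrtC_eq0 oppr_eq0.
pose g1 := r *: a - s *: b; pose g2 := r *: a + s *: b.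
have gE : F3 = g1 * g2.
  have <- : r ^+ 2 *: F2 - s ^+ 2 *: F6 = F3 by rewrite !sqrtCK F3E scaleNr opprK.
  by rewrite aE bE /g1 /g2 -!mul_polyC; ring.
have /andP[g10 g20] : (g1 != 0) && (g2 != 0) by rewrite -negb_or -mulf_eq0 -gE.
have co_ab x : root a x -> ~~ root b x.
  move=> ax; have := @coprimep_root _ F2 F6 x co; rewrite aE bE /root !horner_exp (eqP ax).
  by rewrite expr0n eqxx => /(_ isT); rewrite expf_eq0.
have cg x : root g1 x -> ~~ root g2 x.
  rewrite /root !hornerE => /eqP h1; apply/eqP => h2.
  have ra : r * a.[x] = 0.
    apply: (@mulfI _ 2); rewrite ?pnatr_eq0 // mulr0.
    have -> : 2 * (r * a.[x]) = (r * a.[x] - s * b.[x]) + (r * a.[x] + s * b.[x]) by ring.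
    by rewrite h1 h2 addr0.
  have rb : s * b.[x] = 0 by move: h2; rewrite ra add0r.
  move/eqP: ra; rewrite mulf_eq0 (negPf r0) => /co_ab /negP; apply.
  by move/eqP: rb; rewrite mulf_eq0 (negPf s0).
have mg1 : forall x, root g1 x -> if (x == 0) || (x == 1) then mup x g1 = 1%N else mup x g1 = 3%N.
  move=> x rx; rewrite -(mupMl _ (cg x rx)) -gE; apply: m3.
  by rewrite gE rootM rx.
have mg2 : forall x, root g2 x -> if (x == 0) || (x == 1) then mup x g2 = 1%N else mup x g2 = 3%N.
  move=> x rx; have rx1 : ~~ root g1 x by apply: contraL rx; exact: cg.
  by rewrite -(mupMr _ rx1) -gE; apply: m3; rewrite gE rootM rx orbT.
have := size_mod3 g10 mg1; have := size_mod3 g20 mg2.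
have s12 : (size g1 + size g2 = (size F3).+1)%N.
  rewrite gE size_mul //; have := size_poly_gt0 g1; rewrite g10.
  by case: (size g1).
have [z1 z2] : (size g1 <= 3 * n + 3)%N /\ (size g2 <= 3 * n + 3)%N.
  have sab : (maxn (size a) (size b) <= 3 * n + 3)%N.
    move: sz; rewrite aE bE => sz; rewrite geq_max; apply/andP; split.
      have : (size (a ^+ 2) <= 6 * n + 5)%N by rewrite -sz leq_maxl.
      by have := size_exp a 2; move: (size (a ^+ 2)) (size a); clear; lia.
    have : (size (b ^+ 2) <= 6 * n + 5)%N by rewrite -sz leq_maxr.
    by have := size_exp b 2; move: (size (b ^+ 2)) (size b); clear; lia.
  split; apply: leq_trans sab; rewrite (leq_trans (size_polyD _ _)) //.
    by rewrite size_polyN !size_scale.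
  by rewrite !size_scale.
have x0 : ~~ (root g1 0 && root g2 0) by apply/andP => -[/cg /negP].
have x1 : ~~ (root g1 1 && root g2 1) by apply/andP => -[/cg /negP].
move: x0 x1 s12 s3 z1 z2; move: (root g1 0) (root g2 0) (root g1 1) (root g2 1) (size g1) (size g2) (size F3).
by move=> [] [] [] [] //= a1 a2 a3; clear; lia.
Qed.

End Endgame.

(** * A Riccati equation without rational solutions *)

Section Rational.
Variable C : numClosedFieldType.
Implicit Types (p q S T : {poly C}) (a x : C).

(** Relations between rational functions hold at all but finitely many points, so
infinitude is stated as the possibility to avoid any finite set. *)
Definition infinitely (A : C -> Prop) := forall s : seq C, exists2 x, x \notin s & A x.

Lemma infinitely_nonroot (A : C -> Prop) p : infinitely A -> p != 0 ->
  infinitely (fun x => p.[x] != 0 /\ A x).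
Proof.
move=> infA p0 s; have [r pE] := closed_field_poly_normal p.
have [x] := infA (s ++ r); rewrite mem_cat negb_or => /andP[xs xr] Ax.
exists x => //; split=> //; rewrite pE hornerZ mulf_neq0 ?lead_coef_eq0 //.
by move: xr; rewrite -root_prod_XsubC.
Qed.

Lemma infinitely_eq0 (A : C -> Prop) p : infinitely A ->
  (forall x, A x -> p.[x] = 0) -> p = 0.
Proof.
move=> infA pA; apply/eqP/negPn/negP => p0.
by have [x _ [/eqP px /pA]] := infinitely_nonroot infA p0 [::].
Qed.

Lemma root_poly_size p a b : p != 0 -> a != b -> root p a -> root p b -> (2 < size p)%N.
Proof.
move=> p0 ab pa pb; apply: (@max_poly_roots _ p [:: a; b]) => //=; first by rewrite pa pb.
by rewrite inE ab.
Qed.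

(** For [t = T / S] the hypothesis reads
[3 x (1 - x) (t' + t^2) + 2 (1 - 2 x) t = 0]. At a zero of [t] of order [e > 0]
the lowest coefficient gives [e = 0], or [3 e + 2 = 0] if the zero is 0 or 1;
so [t] has no zeros and [T] is constant in lowest terms. Then [S] vanishes at 0
and 1, and its leading coefficient gives [3 deg S = 4]. *)
Lemma no_rational_solution S T : S != 0 ->
  3%:R *: (X01 C * (T^`() * S - T * S^`() + T ^+ 2)) + 2%:R *: ((1 - 2%:R *: 'X) * T * S) = 0 ->
  T = 0.
Proof.
move=> S0 eqn; apply/eqP/negPn/negP => T0.
wlog co : S T S0 T0 eqn / coprimep S T.
  move=> wl; pose g := gcdp S T.
  have g0 : g != 0 by rewrite gcdp_eq0 negb_and S0.
  have SE : S = (S %/ g) * g by rewrite divpK ?dvdp_gcdl.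
  have TE : T = (T %/ g) * g by rewrite divpK ?dvdp_gcdr.
  have S10 : S %/ g != 0 by apply: contraNneq S0 => e; rewrite SE e mul0r.
  have T10 : T %/ g != 0 by apply: contraNneq T0 => e; rewrite TE e mul0r.
  apply: (wl (S %/ g) (T %/ g)) => //; last by rewrite coprimep_div_gcd ?S0.
  apply: (@mulIf _ (g ^+ 2)); first by rewrite expf_neq0.
  rewrite mul0r -[RHS]eqn [in RHS]SE [in RHS]TE; move: (S %/ g) (T %/ g) => s t.
  by rewrite !derivM -!mul_polyC; ring.
have Troot a : ~~ root T a.
  apply/negP => Ta; have Sa : S.[a] != 0 by apply: (@coprimep_root _ T S) => //; rewrite coprimep_sym.
  (* [h] is [3 (T' S - T S' + T^2)] divided by [('X - a)^e]. *)
  have [f fa TE] := mup_factor a T0.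
  have : (0 < mup a T)%N by rewrite -XsubC_dvd // dvdp_XsubCl.
  move: TE; case: (mup a T) => // e TE _.
  pose h := 3%:R *: (((f *+ e.+1 + ('X - a%:P) * f^`()) * S - ('X - a%:P) * f * S^`()) + 
     ('X - a%:P) ^+ e.+2 * f ^+ 2).
  have eq1 : X01 C * h + 2%:R *: (('X - a%:P) * (1 - 2%:R *: 'X) * f * S) = 0.
    apply: (@mulfI _ (('X - a%:P) ^+ e)); first by rewrite expf_neq0 ?polyXsubC_eq0.
    rewrite mulr0 -[RHS]eqn TE derivM deriv_exp derivB derivX derivC subr0 mul1r /= /h !exprS.
    by rewrite -!mul_polyC; ring.
  have ha : (X01 C).[a] * (3%:R * (e.+1%:R * f.[a] * S.[a])) = 0.
    have := congr1 (fun p : {poly C} => p.[a]) eq1.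
    rewrite /h !(hornerE, hornerMn) subrr !(mul0r, expr0n, mulr0, addr0, subr0) /= => <-.
    by rewrite -mulr_natl; ring.
  have fS : f.[a] * S.[a] != 0 by rewrite mulf_neq0.
  have := ha; rewrite -[e.+1%:R * _ * _]mulrA => /eqP.
  rewrite mulf_eq0 (mulf_eq0 3%:R) pnatr_eq0 /= (mulf_eq0 _ (_ * _)) pnatr_eq0 (negPf fS) /= orbF.
  rewrite /X01 !hornerE mulf_eq0 => /orP [/eqP a0|].
    have eq2 : (1 - 'X) * h + 2%:R *: ((1 - 2%:R *: 'X) * f * S) = 0.
      apply: (@mulfI _ 'X); first by rewrite polyX_eq0.
      by rewrite mulr0 -[RHS]eq1 a0 /X01 -!mul_polyC; ring.
    have := congr1 (fun p : {poly C} => p.[a]) eq2.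
    rewrite /h !(hornerE, hornerMn) subrr !(mul0r, expr0n, mulr0, addr0, subr0) /= a0.
    rewrite subr0 => eq3.
    have : (3 * e.+1 + 2)%:R * (f.[a] * S.[a]) = 0 :> C.
      by rewrite -[RHS]eq3 a0 natrD natrM -(mulr_natl _ e.+1); ring.
    by move/eqP; rewrite mulf_eq0 (negPf fS) pnatr_eq0 addn2.
  rewrite subr_eq0 eq_sym => /eqP a1.
  have eq2 : - 'X * h + 2%:R *: ((1 - 2%:R *: 'X) * f * S) = 0.
    apply: (@mulfI _ ('X - 1%:P)); first by rewrite polyXsubC_eq0.
    by rewrite mulr0 -[RHS]eq1 a1 /X01 -!mul_polyC; ring.
  have := congr1 (fun p : {poly C} => p.[a]) eq2.
  rewrite /h !(hornerE, hornerMn) subrr !(mul0r, expr0n, mulr0, addr0, subr0) /= a1.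
  move=> eq3.
  have : (3 * e.+1 + 2)%:R * (f.[a] * S.[a]) = 0 :> C.
    by rewrite -[RHS]oppr0 -eq3 a1 natrD natrM -(mulr_natl _ e.+1); ring.
  by move/eqP; rewrite mulf_eq0 (negPf fS) pnatr_eq0 addn2.
have [c c0 TE] : exists2 c, c != 0 & T = c%:P.
  have /size_poly1P // : size T == 1%N.
  by apply/negPn/negP => /closed_rootP [a]; apply/negP.
have eq1 : 3%:R *: (X01 C * (c%:P - S^`())) + 2%:R *: ((1 - 2%:R *: 'X) * S) = 0.
  apply: (@mulfI _ c%:P); first by rewrite polyC_eq0.
  by rewrite mulr0 -[RHS]eqn TE derivC -!mul_polyC; ring.
have r0 : root S 0.
  have := congr1 (fun p : {poly C} => p.[0]) eq1.
  rewrite /X01 !hornerE /= !(mulr0, mul0r, subr0, add0r, mul1r) => /eqP.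
  by rewrite mulr1 mulf_eq0 pnatr_eq0.
have r1 : root S 1.
  have := congr1 (fun p : {poly C} => p.[1]) eq1.
  rewrite /X01 !hornerE /= subrr !(mulr0, mul0r, add0r, mulr1) => /eqP.
rewrite (_ : 2 * (1 - 2) = - 2); last by ring.
  by rewrite mulNr oppr_eq0 mulf_eq0 pnatr_eq0.
have := root_poly_size S0 (_ : 0 != 1) r0 r1; rewrite eq_sym oner_eq0 => /(_ isT).
case sS : (size S) => [|[|m]] // m0.
have lS : S`_m.+1 != 0 by have := lead_coef_eq0 S; rewrite lead_coefE sS /= => ->.
have := congr1 (fun p : {poly C} => p`_m.+2) eq1.
have -> : X01 C * (c%:P - S^`()) = (c%:P - S^`()) * 'X - (c%:P - S^`()) * 'X * 'X.
  by rewrite /X01; ring.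
have -> : (1 - 2%:R *: 'X) * S = S - 2%:R *: (S * 'X) by rewrite -!mul_polyC; ring.
rewrite !(coefD, coefZ, coefN, coefMX) /= coefC !coef_deriv coef0.
have -> : S`_m.+2 = 0 by rewrite nth_default // sS.
case: m m0 lS {sS} => // m _ lS; rewrite coefC /= !mul0rn.
rewrite -(mulr_natl _ m.+2) => e.
have : (3 * m.+2)%:R - 4 = 0 :> C.
  apply: (@mulIf _ S`_m.+2) => //; rewrite mul0r -[RHS]e natrM; ring.
by move/eqP; rewrite subr_eq0 eqr_nat; clear; lia.
Qed.
End Rational.

(** * Elementary solutions and logarithmic derivatives *)

Section Riccati.
Variable C : numClosedFieldType.
Implicit Types (p q S T P Q : {poly C}) (x z : C).

(** Euler's equation in the normal form [y'' + ode1 y' + ode0 y = 0]. *)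
Definition ode1 (a b c z : C) := (c - (a + b + 1) * z) / (z * (1 - z)).
Definition ode0 (a b z : C) := - (a * b) / (z * (1 - z)).

(** These relations say that [z^al (1 - z)^be] solves the equation with parameters
[a], [b], [c], and that its exponent differences at 0, 1 and infinity are [d0],
[d1] and [1 - d0 - d1] up to sign. *)
Record elementary (a b c d0 d1 al be : C) : Prop := Elementary {
  elem_al : al * (al + d0) = 0;
  elem_be : be * (be + d1) = 0;
  elem_c : c = 1 - d0 - 2 * al;
  elem_sum : a + b = 1 - d0 - d1 - 2 * (al + be);
  elem_prod : a * b = (al + be) * (al + be - (1 - d0 - d1)) }.

(** The exponents [al] and [be] absorb the signs of the first two differences;
[a + b] is then known, and [a b] follows from [(a - b)^2 = d2^2]. *)
Lemma elementary_exists a b c (d0 d1 d2 : C) : d0 + d1 + d2 = 1 ->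
  (1 - c == d0) || (1 - c == - d0) ->
  (c - a - b == d1) || (c - a - b == - d1) ->
  (a - b == d2) || (a - b == - d2) ->
  exists al be, elementary a b c d0 d1 al be.
Proof.
move=> s /orP h0 /orP h1 /orP h2.
have [al [hal hc]] : exists al, al * (al + d0) = 0 /\ c = 1 - d0 - 2 * al.
  by case: h0 => /eqP h; [exists 0|exists (- d0)]; split; try ring; rewrite -[c](subKr 1) h; ring.
have [be [hbe hc1]] : exists be, be * (be + d1) = 0 /\ a + b = c - d1 - 2 * be.
  case: h1 => /eqP h; [exists 0|exists (- d1)]; split; try ring.
    by rewrite -h; ring.
  by transitivity (c - (c - a - b)); [ring|rewrite h; ring].
exists al, be; split=> //; first by rewrite hc1 hc; ring.
have e2 : (a - b) ^+ 2 = (1 - d0 - d1) ^+ 2.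
  have -> : 1 - d0 - d1 = d2 by rewrite -s; ring.
  by case: h2 => /eqP ->; rewrite ?sqrrN.
apply: (@mulfI _ 4); first by rewrite pnatr_eq0.
transitivity ((a + b) ^+ 2 - (a - b) ^+ 2); first ring.
by rewrite e2 hc1 hc; ring.
Qed.

(** The Riccati equation for the logarithmic derivative of the elementary solution. *)
Lemma elementary_riccati a b c d0 d1 al be z :
  elementary a b c d0 d1 al be -> z != 0 -> 1 - z != 0 ->
  (- al / z ^+ 2 - be / (1 - z) ^+ 2) + (al / z - be / (1 - z)) ^+ 2
    + ode1 a b c z * (al / z - be / (1 - z)) + ode0 a b z = 0.
Proof.
move=> [h0 h1 hc hs hp] z0 z1; rewrite /ode1 /ode0 hs hp hc.
transitivity (- (al * (al + d0)) * (1 / z ^+ 2 + 1 / (z * (1 - z)))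
             - (be * (be + d1)) * (1 / (1 - z) ^+ 2 + 1 / (z * (1 - z)))).
  by field; rewrite z0 z1.
by rewrite h0 h1 oppr0 !mul0r subr0.
Qed.

(** The right-hand side is minus the logarithmic derivative of
[z^(d0 - 1) (1 - z)^(d1 - 1)], the derivative of the quotient of a second solution
by the elementary one. *)
Lemma elementary_ode1 a b c d0 d1 al be z :
  elementary a b c d0 d1 al be -> z != 0 -> 1 - z != 0 ->
  2 * (al / z - be / (1 - z)) + ode1 a b c z = (1 - d0) / z - (1 - d1) / (1 - z).
Proof.
move=> [_ _ hc hs _] z0 z1; rewrite /ode1 hs hc.
by field; rewrite z0 z1.
Qed.

Definition logd p x := p^`().[x] / p.[x].
Definition dlogd p x := p^`()^`().[x] / p.[x] - (p^`().[x] / p.[x]) ^+ 2.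

(** The function [f'] is the derivative of the rational function [f]. The fraction
[T / S] need not be in lowest terms, and the values of [f] and [f'] at the zeros
of [S] are irrelevant. *)
Definition ratpair (f f' : C -> C) := exists T S, S != 0 /\
  forall x, S.[x] != 0 -> f x = T.[x] / S.[x] /\
    f' x = (T^`().[x] * S.[x] - T.[x] * S^`().[x]) / S.[x] ^+ 2.

Lemma ratpairD f f' g g' : ratpair f f' -> ratpair g g' ->
  ratpair (fun x => f x + g x) (fun x => f' x + g' x).
Proof.
move=> [T [S [S0 hf]]] [T' [S' [S0' hg]]]; exists (T * S' + T' * S), (S * S'); split.
  by rewrite mulf_neq0.
move=> x; rewrite hornerM mulf_eq0 negb_or => /andP[sx sx'].
have [-> ->] := hf x sx; have [-> ->] := hg x sx'.
rewrite !(derivD, derivM, hornerD, hornerM).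
by split; field; rewrite sx sx'.
Qed.

Lemma ratpairZ k f f' : ratpair f f' -> ratpair (fun x => k * f x) (fun x => k * f' x).
Proof.
move=> [T [S [S0 hf]]]; exists (k *: T), S; split=> // x sx.
have [-> ->] := hf x sx; rewrite !(derivZ, hornerZ).
by split; field.
Qed.

Lemma ratpair_logd p : p != 0 -> ratpair (logd p) (dlogd p).
Proof.
move=> p0; exists p^`(), p; split=> // x px; split=> //.
by rewrite /dlogd; field.
Qed.

Lemma ratpair0 : ratpair (fun=> 0) (fun=> 0).
Proof.
by exists 0, 1; split; rewrite ?oner_eq0 // => x _; rewrite !raddf0 !horner0 !mul0r subr0 mul0r.
Qed.

Lemma ratpair_sum n (f f' : 'I_n -> C -> C) : (forall i, ratpair (f i) (f' i)) ->
  ratpair (fun x => \sum_(i < n) f i x) (fun x => \sum_(i < n) f' i x).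
Proof.
elim: n f f' => [|n IH] f f' h.
  have [T [S [S0 H]]] := ratpair0; exists T, S; split=> // x /H; rewrite !big_ord0.
  by [].
have := ratpairD (h ord0) (IH _ _ (fun i => h (lift ord0 i))).
move=> [T [S [S0 H]]]; exists T, S; split=> // x /H; rewrite !big_ord_recl.
by [].
Qed.

Lemma X01_horner x : (X01 C).[x] = x * (1 - x).
Proof. by rewrite /X01 !hornerE. Qed.

Lemma ratpair_riccati t t' : ratpair t t' ->
  infinitely (fun x => 3 * (x * (1 - x)) * (t' x + t x ^+ 2) + 2 * ((1 - 2 * x) * t x) = 0) ->
  exists2 B : {poly C}, B != 0 & forall x, B.[x] != 0 -> t x = 0.
Proof.
move=> [T [S [S0 H]]] inf; exists S => //.
suff T0 : T = 0 by move=> x /H [-> _]; rewrite T0 horner0 mul0r.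
apply: (@no_rational_solution _ S T) => //.
apply: (infinitely_eq0 (infinitely_nonroot inf S0)) => x [sx].
have h2 : (1 - 2 *: 'X).[x] = 1 - 2 * x by rewrite !hornerE.
have [-> ->] := H x sx; rewrite hornerD !hornerZ [(X01 C * _).[x]]hornerM X01_horner.
rewrite [(_ * T * S).[x]]hornerM [((1 - _) * T).[x]]hornerM.
rewrite h2 => e; rewrite !(hornerD, hornerM, hornerN, horner_exp).
apply: (@mulIf _ (S.[x] ^- 2)); first by rewrite invr_neq0 // expf_neq0.
by rewrite mul0r -[RHS]e; field; rewrite ?sx.
Qed.

Lemma logdM p q x : p.[x] != 0 -> q.[x] != 0 -> logd (p * q) x = logd p x + logd q x.
Proof. by move=> p0 q0; rewrite /logd derivM !hornerE; field; rewrite p0 q0. Qed.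

Lemma logdX p n x : p.[x] != 0 -> logd (p ^+ n) x = n%:R * logd p x.
Proof.
move=> p0; elim: n => [|n IH]; first by rewrite expr0 mul0r /logd -(polyC1 C) derivC horner0 mul0r.
by rewrite exprS logdM ?horner_exp ?expf_neq0 // IH mulrS mulrDl mul1r.
Qed.

(** With [p / q = s / t] in lowest terms, [s' t = s t'] makes [s] divide [s'], so [s]
and likewise [t] are constant. *)
Lemma logd_eq p q : p != 0 -> q != 0 -> infinitely (fun x => logd p x = logd q x) ->
  exists2 k, k != 0 & p = k *: q.
Proof.
move=> p0 q0 inf.
have e : p^`() * q = p * q^`().
  apply/eqP; rewrite -subr_eq0; apply/eqP.
  apply: (infinitely_eq0 (infinitely_nonroot inf (mulf_neq0 p0 q0))) => x.
  rewrite /logd !hornerE mulf_eq0 negb_or => -[/andP[px qx] e].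
  by rewrite -[p^`().[x]](divfK px) e; field.
pose g := gcdp p q.
have g0 : g != 0 by rewrite gcdp_eq0 negb_and p0.
have pE : p = (p %/ g) * g by rewrite divpK ?dvdp_gcdl.
have qE : q = (q %/ g) * g by rewrite divpK ?dvdp_gcdr.
have co : coprimep (p %/ g) (q %/ g) by rewrite coprimep_div_gcd ?p0.
have p10 : p %/ g != 0 by apply: contraNneq p0 => z; rewrite pE z mul0r.
have q10 : q %/ g != 0 by apply: contraNneq q0 => z; rewrite qE z mul0r.
have e1 : (p %/ g)^`() * (q %/ g) = (p %/ g) * (q %/ g)^`().
  apply: (@mulIf _ (g ^+ 2)); first by rewrite expf_neq0.
  apply: (@addrI _ ((p %/ g) * g^`() * (q %/ g) * g)).
  have := e; rewrite [in X in X -> _]pE [in X in X -> _]qE !derivM; move: (p %/ g) (q %/ g) => s t e'.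
  by transitivity ((s^`() * g + s * g^`()) * (t * g)); [ring|rewrite e'; ring].
have cst (s t : {poly C}) : s != 0 -> coprimep s t -> s^`() * t = s * t^`() -> size s = 1%N.
  move=> s0 cst e'; have : s %| s^`() * t by rewrite e' dvdp_mulr.
  rewrite Gauss_dvdpl // => d.
  have s' : s^`() = 0 by apply/eqP; apply: contraLR d => s'; rewrite gtNdvdp // lt_size_deriv.
  apply/eqP; rewrite eqn_leq size_poly_gt0 s0 andbT leqNgt; apply/negP => lt.
  have : s^`()`_(size s).-2 = 0 by rewrite s' coef0.
  move: (lead_coef_eq0 s); rewrite coef_deriv lead_coefE (negPf s0).
  case: (size s) lt => [|[|m]] //= _ h /eqP.
  by rewrite mulrn_eq0 /= h.
have s1 := cst _ _ p10 co e1.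
have s2 : size (q %/ g) = 1%N.
  by apply: (cst _ (p %/ g)) => //; [rewrite coprimep_sym|rewrite mulrC -e1 mulrC].
move/eqP/size_poly1P: s1 => [k k0 kE]; move/eqP/size_poly1P: s2 => [l l0 lE].
exists (k / l); first by rewrite mulf_neq0 ?invr_neq0.
by rewrite pE qE kE lE !mul_polyC scalerA divfK.
Qed.

End Riccati.

(** * The identity satisfied by a covering *)

Section Identity.
Variable C : numClosedFieldType.
Implicit Types (p q S T P Q : {poly C}) (x z : C).

(** The quotient of two polynomials and its first two derivatives, [wronsk P Q]
being the numerator of the first one. *)
Definition quot P Q x := P.[x] / Q.[x].
Definition quot1 P Q x := (wronsk P Q).[x] / Q.[x] ^+ 2.
Definition quot2 P Q x :=
  ((wronsk P Q)^`().[x] * Q.[x] - 2 * (wronsk P Q).[x] * Q^`().[x]) / Q.[x] ^+ 3.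

(** The vanishing of the coefficients of [y'] and [y] in the equation with parameters
[a'], [b'], [c'] for [theta (y o phi)], where [y] solves the equation with
parameters [a], [b], [c], [phi = P / Q] and [u = theta' / theta]. *)
Record pullback_ode a b c a' b' c' P Q (u u' : C -> C) x : Prop := PullbackOde {
  pullback_ode1 : 2 * u x * quot1 P Q x + quot2 P Q x + ode1 a' b' c' x * quot1 P Q x
    - quot1 P Q x ^+ 2 * ode1 a b c (quot P Q x) = 0;
  pullback_ode0 : u' x + u x ^+ 2 + ode1 a' b' c' x * u x + ode0 a' b' x
    - quot1 P Q x ^+ 2 * ode0 a b (quot P Q x) = 0 }.

Lemma wronsk_deriv P Q : (wronsk P Q)^`() = P^`()^`() * Q - P * Q^`()^`().
Proof. by rewrite /wronsk derivB !derivM; ring. Qed.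

(** If [psi] and [v] are the logarithmic derivatives of solutions of the two
equations, so is [u + f1 psi] for the second one; the difference of the Riccati
equations of [u + f1 psi] and [v] is the conclusion. *)
Lemma riccati_transfer (u u' p' q' f1 f2 p q psi psi' v v' : C) :
  2 * u * f1 + f2 + p' * f1 - f1 ^+ 2 * p = 0 ->
  u' + u ^+ 2 + p' * u + q' - f1 ^+ 2 * q = 0 ->
  psi' + psi ^+ 2 + p * psi + q = 0 ->
  v' + v ^+ 2 + p' * v + q' = 0 ->
  (u' + f2 * psi + f1 ^+ 2 * psi' - v') + (u + f1 * psi - v) ^+ 2
     + (2 * v + p') * (u + f1 * psi - v) = 0.
Proof.
move=> h1 h2 h3 h4.
transitivity ((u' + u ^+ 2 + p' * u + q' - f1 ^+ 2 * q)
  + psi * (2 * u * f1 + f2 + p' * f1 - f1 ^+ 2 * p)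
  + f1 ^+ 2 * (psi' + psi ^+ 2 + p * psi + q) - (v' + v ^+ 2 + p' * v + q')); first ring.
by rewrite h1 h2 h3 h4; ring.
Qed.

Lemma logd_quot P Q x : P.[x] != 0 -> Q.[x] != 0 ->
  logd P x - logd Q x = quot1 P Q x / quot P Q x /\
  dlogd P x - dlogd Q x = quot2 P Q x / quot P Q x - (quot1 P Q x / quot P Q x) ^+ 2.
Proof.
move=> p0 q0; rewrite /logd /dlogd /quot2 wronsk_deriv /quot1 /quot /wronsk.
rewrite !(hornerD, hornerN, hornerM).
by split; field; rewrite p0 q0.
Qed.

Lemma quot_compl P Q x : Q.[x] != 0 ->
  [/\ quot (Q - P) Q x = 1 - quot P Q x, quot1 (Q - P) Q x = - quot1 P Q x
    & quot2 (Q - P) Q x = - quot2 P Q x].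
Proof.
move=> q0; rewrite /quot2 !wronsk_deriv /quot1 /quot /wronsk !derivB.
rewrite !(hornerD, hornerN, hornerM).
by split; field.
Qed.

(** Here [t] is the logarithmic derivative of the pulled-back elementary solution
minus that of the elementary solution of the second equation. It vanishes by
[ratpair_riccati], which gives [u]; the coefficient of [y'] then equates the
logarithmic derivatives of both sides. *)
Lemma covering_identity a b c (e0 e1 : C) al be a' b' c' al' be' P Q u u' (m0 m1 : nat) :
  elementary a b c e0 e1 al be ->
  elementary a' b' c' (1 / 3) (1 / 3) al' be' ->
  6 * e0 = m0%:R -> 6 * e1 = m1%:R -> (m0 <= 6)%N -> (m1 <= 6)%N ->
  wronsk P Q != 0 -> ratpair u u' ->
  infinitely (pullback_ode a b c a' b' c' P Q u u') ->
  exists2 k, k != 0 & wronsk P Q ^+ 6 * X01 C ^+ 4 =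
     k *: (P ^+ (6 - m0) * (Q - P) ^+ (6 - m1) * Q ^+ (m0 + m1)).
Proof.
move=> el el' hm0 hm1 m06 m16 W0 ru inf.
have P0 : P != 0 by apply: contraNneq W0 => ->; rewrite /wronsk raddf0 !mul0r subr0.
have Q0 : Q != 0 by apply: contraNneq W0 => ->; rewrite /wronsk raddf0 !mulr0 subr0.
have QP0 : Q - P != 0.
  by apply: contraNneq W0 => /eqP; rewrite subr_eq0 => /eqP ->; rewrite /wronsk mulrC subrr.
have X0 : 'X != 0 :> {poly C} by rewrite polyX_eq0.
have X1 : 1 - 'X != 0 :> {poly C} by rewrite -opprB oppr_eq0 -[1]/(1%:P) polyXsubC_eq0.
pose bad := wronsk P Q * (P * Q * (Q - P) * ('X * (1 - 'X))).
have bad0 : bad != 0 by rewrite !mulf_neq0.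
have badP x : bad.[x] != 0 -> [/\ (wronsk P Q).[x] != 0, P.[x] != 0, Q.[x] != 0, (Q - P).[x] != 0 & (x != 0) && (1 - x != 0)].
  rewrite /bad !hornerM !mulf_eq0 !negb_or hornerX => /andP[-> /andP[/andP[/andP[-> ->] ->]]].
  by rewrite !hornerE.
pose t x := u x + (al * (logd P x + -1 * logd Q x) + (be * (logd (Q - P) x + -1 * logd Q x)
   + (- al' * logd 'X x + - be' * logd (1 - 'X) x))).
pose t' x := u' x + (al * (dlogd P x + -1 * dlogd Q x) + (be * (dlogd (Q - P) x + -1 * dlogd Q x)
   + (- al' * dlogd 'X x + - be' * dlogd (1 - 'X) x))).
have rt : ratpair t t'.
  by do ?apply: ratpairD => //; apply: ratpairZ; do ?apply: ratpairD => //; rewrite ?ratpair_logd //; do ?apply: ratpairZ; apply: ratpair_logd.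
have lX x : logd 'X x = 1 / x by rewrite /logd derivX !hornerE.
have d1 : (1 : {poly C})^`() = 0 by rewrite -(polyC1 C) derivC.
have h1 x : (1 : {poly C}).[x] = 1 by rewrite hornerC.
have lX1 x : logd (1 - 'X) x = - 1 / (1 - x).
  by rewrite /logd derivB d1 derivX sub0r hornerN hornerD hornerN hornerX !h1.
have dX x : dlogd 'X x = - 1 / x ^+ 2.
  by rewrite /dlogd derivX d1 horner0 h1 hornerX mul0r sub0r mul1r exprVn mulN1r.
have dX1 x : dlogd (1 - 'X) x = - 1 / (1 - x) ^+ 2.
  rewrite /dlogd derivB d1 derivX sub0r derivN d1 oppr0 horner0 mul0r sub0r.
  by rewrite hornerN hornerD hornerN hornerX !h1 exprMn sqrrN expr1n mul1r exprVn mulN1r.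
have tE x : bad.[x] != 0 -> [/\ quot P Q x != 0, 1 - quot P Q x != 0, 
   t x = u x + quot1 P Q x * (al / quot P Q x - be / (1 - quot P Q x)) - (al' / x - be' / (1 - x)) &
   t' x = u' x + quot2 P Q x * (al / quot P Q x - be / (1 - quot P Q x)) 
     + quot1 P Q x ^+ 2 * (- al / quot P Q x ^+ 2 - be / (1 - quot P Q x) ^+ 2)
     - (- al' / x ^+ 2 - be' / (1 - x) ^+ 2)].
  move=> /badP [_ px qx qpx /andP[x0 x1]].
  have f0 : quot P Q x != 0 by rewrite /quot mulf_neq0 ?invr_neq0.
  have [E0 E1 E2] := quot_compl P qx.
  have f1 : 1 - quot P Q x != 0 by rewrite -E0 /quot mulf_neq0 ?invr_neq0.
  split=> //.
    rewrite /t !mulN1r (logd_quot px qx).1 (logd_quot qpx qx).1 E0 E1 lX lX1.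
    by field; rewrite f0 f1 x0 x1.
  rewrite /t' !mulN1r (logd_quot px qx).2 (logd_quot qpx qx).2 E0 E1 E2 dX dX1.
  by field; rewrite f0 f1 x0 x1.
have inf' := infinitely_nonroot inf bad0.
have [B B0 tB] : exists2 B : {poly C}, B != 0 & forall x, B.[x] != 0 -> t x = 0.
  apply: (ratpair_riccati rt) => s; have [x xs [bx [i1 i0]]] := inf' s; exists x => //.
  have [_ _ _ _ /andP[x0 x1]] := badP x bx.
  have [f0 f1 -> ->] := tE x bx.
  have := riccati_transfer i1 i0 (elementary_riccati el f0 f1) (elementary_riccati el' x0 x1).
  rewrite (elementary_ode1 el' x0 x1) => e.
  apply: (@mulIf _ (3 * (x * (1 - x)))^-1); first by rewrite invr_neq0 // !mulf_neq0 // pnatr_eq0.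
  rewrite mul0r -[RHS]e; field.
  by rewrite x0 x1 f0 f1.
apply: logd_eq.
- by rewrite mulf_neq0 ?expf_neq0 // mulf_neq0.
- by rewrite !mulf_neq0 ?expf_neq0.
move=> s; have [x xs [Bx [bx [i1 _]]]] := infinitely_nonroot inf' B0 s; exists x => //.
have [wx px qx qpx /andP[x0 x1]] := badP x bx.
have Xx : (X01 C).[x] != 0 by rewrite X01_horner mulf_neq0.
have X0x : 'X.[x] != 0 by rewrite hornerX.
have X1x : (1 - 'X).[x] != 0 by rewrite !hornerE.
have [f0 f1 e _] := tE x bx; move: e; rewrite (tB x Bx) => e.
have [E0 E1 E2] := quot_compl P qx.
have ex p m : p.[x] != 0 -> (p ^+ m).[x] != 0 by move=> p0; rewrite horner_exp expf_neq0.
have lX01 : logd (X01 C) x = 1 / x - 1 / (1 - x).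
  by rewrite -mulNr -lX -lX1; apply: logdM.
rewrite (logdM (ex _ 6%N wx) (ex _ 4%N Xx)) !logdX // lX01.
have pq0 := ex _ (6 - m0)%N px; have qpq0 := ex _ (6 - m1)%N qpx; have qq0 := ex _ (m0 + m1)%N qx.
have pqpq0 : (P ^+ (6 - m0) * (Q - P) ^+ (6 - m1)).[x] != 0 by rewrite hornerM mulf_neq0.
rewrite (logdM pqpq0 qq0) (logdM pq0 qpq0) !logdX //.
rewrite !natrB // natrD -hm0 -hm1.
have hu : u x = al' / x - be' / (1 - x) - quot1 P Q x * (al / quot P Q x - be / (1 - quot P Q x)).
  by rewrite -[LHS](addr0) -[X in _ + X]oppr0 [X in - X]e; ring.
have w2 : quot2 P Q x = quot1 P Q x * (logd (wronsk P Q) x - 2 * logd Q x).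
  by rewrite /quot1 /quot2 /logd; field; rewrite wx qx.
have F0 : quot1 P Q x != 0 by rewrite mulf_neq0 // invr_neq0 // expf_neq0.
have L1 : logd P x = quot1 P Q x / quot P Q x + logd Q x.
  by rewrite -(logd_quot px qx).1 subrK.
have L2 : logd (Q - P) x = - quot1 P Q x / (1 - quot P Q x) + logd Q x.
  by rewrite -E0 -E1 -(logd_quot qpx qx).1 subrK.
have e2 := elementary_ode1 el f0 f1.
have e3 := elementary_ode1 el' x0 x1.
move: i1; rewrite hu w2.
have -> : ode1 a b c (quot P Q x) = (1 - e0) / quot P Q x - (1 - e1) / (1 - quot P Q x) - 2 * (al / quot P Q x - be / (1 - quot P Q x)).
  by rewrite -e2; ring.
have -> : ode1 a' b' c' x = (1 - 1 / 3) / x - (1 - 1 / 3) / (1 - x) - 2 * (al' / x - be' / (1 - x)).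
  by rewrite -e3; ring.
rewrite L1 L2; move: (quot P Q x) f0 f1 (quot1 P Q x) F0 (logd Q x) (logd (wronsk P Q) x) => f f0 f1 g g0 lq lw i1.
apply/eqP; rewrite -subr_eq0; apply/eqP.
apply: (@mulIf _ (g / 6)); first by rewrite mulf_neq0 // invr_neq0 // pnatr_eq0.
rewrite mul0r -[RHS]i1; field.
by rewrite x0 x1 f0 f1.
Qed.

End Identity.

(** * All orders of the singular points *)

Section Perm.
Variable C : numClosedFieldType.
Implicit Types (p q P Q : {poly C}).

Lemma max_size_sub P Q : maxn (size P) (size (Q - P)) = maxn (size P) (size Q).
Proof.
have h (p q : {poly C}) : (size (q - p)%R <= maxn (size p) (size q))%N.
  by rewrite maxnC -(size_polyN p) size_polyD.
apply/eqP; rewrite eqn_leq !geq_max !leq_maxl h /=.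
by rewrite -{1}(subrK P Q) maxnC size_polyD.
Qed.

Lemma coprimep_sub P Q : coprimep P (Q - P) = coprimep P Q.
Proof. by rewrite addrC -mulN1r coprimep_addl_mul. Qed.

(** The fibres over 0, infinity and 1 are [P], [Q] and [Q - P]. They are linearly
dependent and their pairwise Wronskians agree up to sign, so their roles can be
exchanged. *)
Lemma no_covering_any_order P Q m0 m1 m2 k n :
  coprimep P Q -> maxn (size P) (size Q) = (6 * n + 5)%N -> wronsk P Q != 0 ->
  perm_eq [:: m0; m1; m2] [:: 3; 2; 1]%N -> k != 0 ->
  wronsk P Q ^+ 6 * X01 C ^+ 4 = k *: (P ^+ (6 - m0) * (Q - P) ^+ (6 - m1) * Q ^+ (m0 + m1)) ->
  False.
Proof.
move=> co sz W0 pm k0 K.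
have N1 : -1 != 0 :> C by rewrite oppr_eq0 oner_eq0.
have O1 := oner_neq0 C.
have WN : wronsk Q P = - wronsk P Q by rewrite /wronsk; ring.
have W1 : wronsk P (Q - P) = wronsk P Q by rewrite /wronsk derivB; ring.
have W2 : wronsk (Q - P) P = - wronsk P Q by rewrite /wronsk derivB; ring.
have W3 : wronsk Q (Q - P) = wronsk P Q by rewrite /wronsk derivB; ring.
have W4 : wronsk (Q - P) Q = - wronsk P Q by rewrite /wronsk derivB; ring.
have X6 (w : {poly C}) : (- w) ^+ 6 = w ^+ 6 by rewrite (exprM _ 2 3) sqrrN -exprM.
have WN0 : - wronsk P Q != 0 by rewrite oppr_eq0.
have co' : coprimep Q P by rewrite coprimep_sym.
have co1 : coprimep P (Q - P) by rewrite coprimep_sub.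
have co1' : coprimep (Q - P) P by rewrite coprimep_sym.
have co2 : coprimep Q (Q - P) by rewrite -opprB -scaleN1r coprimepZr // coprimep_sub //.
have co2' : coprimep (Q - P) Q by rewrite coprimep_sym.
have sz' : maxn (size Q) (size P) = (6 * n + 5)%N by rewrite maxnC.
have sz1 : maxn (size P) (size (Q - P)) = (6 * n + 5)%N by rewrite max_size_sub.
have sz1' : maxn (size (Q - P)) (size P) = (6 * n + 5)%N by rewrite maxnC.
have sz2 : maxn (size Q) (size (Q - P)) = (6 * n + 5)%N.
  by rewrite -(size_polyN (Q - P)) opprB max_size_sub.
have sz2' : maxn (size (Q - P)) (size Q) = (6 * n + 5)%N by rewrite maxnC.
have : [:: m0; m1; m2] \in permutations [:: 3; 2; 1]%N by rewrite mem_permutations.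
rewrite (_ : permutations _ = [:: [:: 2; 3; 1]; [:: 3; 2; 1]; [:: 1; 3; 2]; [:: 3; 1; 2]; [:: 2; 1; 3]; [:: 1; 2; 3]]%N); last by [].
rewrite !inE => /orP[|/orP[|/orP[|/orP[|/orP[]]]]] /eqP [e0 e1 _]; move: K; rewrite {}e0 {}e1.
- move=> K; apply: (@no_elliptic_covering C (Q - P) P Q (-1) 1 k n); rewrite ?W4 ?X6 //.
    by rewrite scaleN1r scale1r; ring.
  by rewrite K [P ^+ _ * _]mulrC.
- move=> K; apply: (@no_elliptic_covering C P (Q - P) Q (-1) 1 k n) => //.
  by rewrite scaleN1r scale1r; ring.
- move=> K; apply: (@no_elliptic_covering C (Q - P) Q P 1 1 k n); rewrite ?W2 ?X6 //.
    by rewrite !scale1r; ring.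
  by rewrite K -mulrA [P ^+ _ * _]mulrC.
- move=> K; apply: (@no_elliptic_covering C P Q (Q - P) 1 1 k n); rewrite ?W1 //.
    by rewrite !scale1r; ring.
  by rewrite K mulrAC.
- move=> K; apply: (@no_elliptic_covering C Q P (Q - P) 1 (-1) k n); rewrite ?W3 //.
    by rewrite scaleN1r scale1r; ring.
  by rewrite K [_ * Q ^+ _]mulrC mulrA.
- move=> K; apply: (@no_elliptic_covering C Q (Q - P) P 1 (-1) k n); rewrite ?WN ?X6 //.
    by rewrite scaleN1r scale1r; ring.
  by rewrite K [P ^+ _ * _]mulrC [_ * Q ^+ _]mulrC mulrA.
Qed.

End Perm.

Local Open Scope classical_set_scope.
Local Open Scope complex_scope.

(** * Derivatives by epsilon and delta *)

Section Crit.
Variable K : numFieldType.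

Let G (f : K^o -> K^o) (x h : K^o) : K^o := h^-1 *: ((f \o shift x) (h *: (1 : K^o)) - f x).

Let GE (f : K^o -> K^o) (x df h : K^o) : h != 0 ->
  `|df - G f x h| = `|f (x + h) - f x - h * df| / `|h|.
Proof.
move=> h0; rewrite -normfV -normrM distrC.
have -> : G f x h = h^-1 * (f (x + h) - f x).
  by rewrite /G /= [h *: 1]mulr1 [h + x]addrC.
suff -> : h^-1 * (f (x + h) - f x) - df = (f (x + h) - f x - h * df) / h by [].
by rewrite mulrBl [h * df]mulrC mulfK // mulrC.
Qed.

Lemma is_derive_epsP (f : K^o -> K^o) (x df : K^o) :
  is_derive x (1 : K^o) f df <->
  (forall e : K, 0 < e -> exists2 d : K, 0 < d &
     forall h : K, `|h| < d -> `|f (x + h) - f x - h * df| <= e * `|h|).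
Proof.
split.
  move=> [F dfE] e e0.
  have {}F : G f x @ 0^' --> df by rewrite -dfE; exact: F.
  have /cvgrPdist_le /(_ e e0) := F.
  rewrite near_withinE near_simpl => /nbhs_ballP [d /= d0 H]; exists d => // h hd.
  have [->|h0] := eqVneq h 0.
    by rewrite addr0 subrr mul0r subr0 normr0 mulr0.
  have := H h; rewrite /ball /= sub0r normrN => /(_ hd h0).
  by rewrite GE // ler_pdivrMr ?normr_gt0.
move=> H.
have F : G f x @ 0^' --> df.
  apply/cvgrPdist_le => e e0; have [d d0 Hd] := H e e0.
  rewrite near_withinE near_simpl; apply/nbhs_ballP; exists d => //= h.
  rewrite /ball /= sub0r normrN => hd h0.
  by rewrite GE // ler_pdivrMr ?normr_gt0 ?Hd.
by apply: DeriveDef; [apply/cvg_ex; exists df|apply/cvg_lim].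
Qed.
End Crit.

(** * Complex differentiation *)

Section Calculus.
Variable R : realType.
Local Notation C := (R[i]^o).
Implicit Types (x z w h : C) (f g : C -> C).

Lemma gt0_complexP (e : R[i]) : 0 < e -> e = (complex.Re e)%:C /\ 0 < complex.Re e.
Proof.
move=> e0; have er : e \is Num.real by rewrite gtr0_real.
have <- := RRe_real er; split=> //.
by move: e0; rewrite -{1}(RRe_real er) ltcR.
Qed.

Lemma normc_normE (z : C) : `|z| = (normc z)%:C.
Proof. by case: z => a b; exact: (normc_def (a +i* b)). Qed.

Lemma normc_ge0 (z : C) : 0 <= normc z.
Proof. by case: z => a b; exact: sqrtr_ge0. Qed.

Lemma is_derive_normcP f x (df : C) :
  is_derive x (1 : C) f df <->
  (forall e : R, 0 < e -> exists2 d : R, 0 < d &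
     forall h, normc h < d -> normc (f (x + h) - f x - h * df) <= e * normc h).
Proof.
split=> [/is_derive_epsP H e e0|H].
  have [|d d0 Hd] := H e%:C; first by rewrite ltcR.
  have [dE d0'] := gt0_complexP d0; exists (complex.Re d) => // h hd.
  by have := Hd h; rewrite !normc_normE dE ltcR hd -rmorphM /= lecR => /(_ isT).
apply/is_derive_epsP => e e0; have [eE e0'] := gt0_complexP e0.
have [d d0 Hd] := H _ e0'; exists d%:C; first by rewrite ltcR.
by move=> h; rewrite !normc_normE ltcR eE -rmorphM lecR => /Hd.
Qed.

Lemma nbhs_normcP x (A : set C) :
  nbhs x A <-> exists2 d : R, 0 < d & forall h, normc h < d -> A (x + h).
Proof.
split=> [/nbhs_ballP [d /= d0 H]|[d d0 H]].
  have [dE d0'] := gt0_complexP d0; exists (complex.Re d) => // h hd; apply: H.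
  by rewrite /ball /= opprD addrA subrr add0r normrN normc_normE dE ltcR.
apply/nbhs_ballP; exists d%:C; first by rewrite /= ltcR.
move=> y; rewrite /ball /= => hy; rewrite -(subrK x y) addrC; apply: H.
by rewrite -ltcR -normc_normE distrC.
Qed.

Lemma continuous_normcP f x :
  {for x, continuous f} <->
  (forall e : R, 0 < e -> exists2 d : R, 0 < d &
     forall h, normc h < d -> normc (f (x + h) - f x) < e).
Proof.
split=> [H e e0|H].
  have /cvgrPdist_lt /(_ e%:C) := H; rewrite ltcR => /(_ e0) /nbhs_normcP [d d0 Hd].
  by exists d => // h /Hd; rewrite distrC normc_normE ltcR.
apply/(@cvgrPdist_lt _ _ _ (nbhs x) (nbhs_filter x)) => e e0; have [eE e0'] := gt0_complexP e0; have [d d0 Hd] := H _ e0'.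
by apply/nbhs_normcP; exists d => // h /Hd; rewrite distrC normc_normE eE ltcR.
Qed.

Lemma is_derive_continuous f x (df : C) : is_derive x (1 : C) f df -> {for x, continuous f}.
Proof. move=> [F _]; have := (@derivable1_diffP R[i] C f x).1 F.
exact: (@differentiable_continuous R[i] C C x f).
Qed.

Lemma is_derive_derive1 f x (df : C) : is_derive x (1 : C) f df -> derive1 f x = df.
Proof. by move=> [_ <-]; rewrite derive1E. Qed.

Lemma is_deriveMc f g x (df dg : C) : is_derive x (1 : C) f df -> is_derive x (1 : C) g dg ->
  is_derive x (1 : C) (fun z => f z * g z) (df * g x + f x * dg).
Proof.
move=> F G; rewrite addrC [df * g x]mulrC.
exact: (@is_deriveM R[i] C f g x 1 df dg F G).
Qed.

Lemma is_deriveDc f g x (df dg : C) : is_derive x (1 : C) f df -> is_derive x (1 : C) g dg ->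
  is_derive x (1 : C) (fun z => f z + g z) (df + dg).
Proof. by move=> F G; exact: (@is_deriveD R[i] C C f g x 1 df dg F G). Qed.

Lemma is_deriveZc (k : C) f x (df : C) : is_derive x (1 : C) f df ->
  is_derive x (1 : C) (fun z => k * f z) (k * df).
Proof. by move=> F; exact: (@is_deriveZ R[i] C C f k x 1 df F). Qed.

Lemma is_derive_cstc (k : C) x : is_derive x (1 : C) (fun=> k) (0 : C).
Proof. exact: (@is_derive_cst R[i] C C k x 1). Qed.

Lemma is_derive_idc x : is_derive x (1 : C) (fun z => z) (1 : C).
Proof. exact: (@is_derive_id R[i] C x 1). Qed.

Lemma is_derive_near f g x (df : C) : (\forall z \near x, f z = g z) ->
  is_derive x (1 : C) f df -> is_derive x (1 : C) g df.
Proof.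
by move=> fg; apply: (@near_eq_is_derive R[i] C C f g x (1 : C) df fg).
Qed.

Lemma is_derive_compc f g x (df dg : C) : is_derive x (1 : C) g dg ->
  is_derive (g x) (1 : C) f df -> is_derive x (1 : C) (fun z => f (g z)) (dg * df).
Proof.
move=> [dg1 dgE] [df1 dfE].
have diffg := (@derivable1_diffP R[i] C g x).1 dg1.
have difff := (@derivable1_diffP R[i] C f (g x)).1 df1.
have diffc := @differentiable_comp R[i] C C C g f x diffg difff.
apply: DeriveDef; first exact: (@derivable1_diffP R[i] C _ x).2 diffc.
have := @diff_comp R[i] C C C g f x diffg difff.
have := @deriv1E R[i] C g x dg1.
have := @deriv1E R[i] C f (g x) df1.
have := @derive1E' R[i] C (f \o g) x diffc.
rewrite !derive1E dgE dfE => e1 e2 e3 e4.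
have a1 := eq_trans (congr1 (fun k : C -> C => k (1 : C)) e3) (scale1r dg).
have a2 := congr1 (fun k : C -> C => k dg) e2.
have a3 := congr1 (fun k : C -> C => k (1 : C)) e4.
apply: eq_trans e1 _; apply: eq_trans a3 _.
by apply: eq_trans (congr1 ('d f (g x) : C -> C) a1) a2.
Qed.
End Calculus.

(** * The complex exponential and logarithm *)

Section ExpLog.
Variable R : realType.
Local Notation C := (R[i]^o).
Implicit Types (x z w h : C) (f g : C -> C).

Lemma Re_le_normc z : `|complex.Re z| <= normc z.
Proof.
case: z => a b /=; rewrite -sqrtr_sqr ler_wsqrtr // lerDl sqr_ge0 //.
Qed.

Lemma Im_le_normc z : `|complex.Im z| <= normc z.
Proof.
case: z => a b /=; rewrite -sqrtr_sqr ler_wsqrtr // lerDr sqr_ge0 //.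
Qed.

Lemma normc_le z : normc z <= `|complex.Re z| + `|complex.Im z|.
Proof.
case: z => a b /=; rewrite -[leRHS]ger0_norm ?addr_ge0 // -sqrtr_sqr ler_wsqrtr //.
by rewrite sqrrD !real_normK ?num_real // addrAC lerDl mulrn_wge0 // mulr_ge0.
Qed.

Lemma cexpD z w : cexp (z + w) = cexp z * cexp w.
Proof.
case: z => a b; case: w => c d; rewrite /cexp /= expRD cosD sinD.
by apply/eqP; rewrite eq_complex /=; apply/andP; split; apply/eqP; ring.
Qed.

Lemma cexp0 : cexp 0 = 1 :> C.
Proof.
rewrite /cexp /= expR0 cos0 sin0.
by apply/eqP; rewrite eq_complex /= !mulr0 !mul0r mulr1 subr0 addr0 !eqxx.
Qed.

Lemma cexp_neq0 z : cexp z != 0.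
Proof.
apply/eqP => e; have := cexpD z (- z); rewrite subrr cexp0 e mul0r => /eqP.
by rewrite oner_eq0.
Qed.

Lemma is_derive_real_eps (f : R -> R) (x df : R) : is_derive x (1 : R) f df ->
  forall e : R, 0 < e -> exists2 d : R, 0 < d &
    forall h : R, `|h| < d -> `|f (x + h) - f x - h * df| <= e * `|h|.
Proof. exact: (@is_derive_epsP R f x df).1. Qed.

Lemma is_derive_cexp z : is_derive z (1 : C) (@cexp R) (cexp z).
Proof.
suff H (e : R) : 0 < e -> exists2 d : R, 0 < d & forall h : C, normc h < d -> normc (cexp h - 1 - h) <= e * normc h.
  apply/is_derive_normcP => e e0.
  have n0 : 0 < 1 + normc (cexp z) by rewrite ltr_pwDl ?normc_ge0.
  have [|d d0 Hd] := H (e / (1 + normc (cexp z))); first by rewrite divr_gt0.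
  exists d => // h /Hd hh.
  have -> : cexp (z + h) - cexp z - h * cexp z = cexp z * (cexp h - 1 - h) :> C.
    by rewrite cexpD; ring.
  rewrite normcM; apply: le_trans (ler_wpM2l (normc_ge0 _) hh) _.
  rewrite mulrA ler_wpM2r ?normc_ge0 // mulrCA ler_piMr ?(ltW e0) //.
  by rewrite ler_pdivrMr // mul1r lerDr.
move=> e0; pose e1 := Num.min 1 (e / 9).
have e10 : 0 < e1 by rewrite lt_min ltr01 divr_gt0.
have e11 : e1 <= 1 by rewrite ge_min lexx.
have e19 : e1 <= e / 9 by rewrite ge_min lexx orbT.
move: e1 e10 e11 e19 => e1 e10 e11 e19.
have [d1 d10 H1] := is_derive_real_eps (is_derive_expR (0 : R)) e10.
have [d2 d20 H2] := is_derive_real_eps (is_derive_sin (0 : R)) e10.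
have [d3 d30 H3] := is_derive_real_eps (is_derive_cos (0 : R)) e10.
exists (Num.min e1 (Num.min d1 (Num.min d2 d3))); first by rewrite !lt_min e10 d10 d20.
move=> h; rewrite !lt_min => /and4P[he h1 h2 h3].
have re := Re_le_normc h; have im := Im_le_normc h; have n0 := normc_ge0 h.
set a := complex.Re h in re *; set b := complex.Im h in im *; set n := normc h in re im he h1 h2 h3 n0 *.
have := H1 a (le_lt_trans re h1); have := H2 b (le_lt_trans im h2); have := H3 b (le_lt_trans im h3).
rewrite !add0r expR0 cos0 sin0 !mulr1 subr0 oppr0 mulr0 subr0.
have hE : h = a +i* b by rewrite /a /b; case: (h).
have -> : cexp h - 1 - h = (expR a * cos b - 1 - a) +i* (expR a * sin b - b).
  by rewrite /cexp -/a -/b hE; apply/eqP; rewrite eq_complex /=; apply/andP; split; apply/eqP; ring.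
move=> hc hs hE'; apply: le_trans (normc_le _) _; rewrite /=.
set E := expR a - 1 - a in hE'; set c := cos b - 1 in hc; set s := sin b - b in hs.
have {}hE' : `|E| <= e1 * n by apply: le_trans hE' _; rewrite ler_wpM2l // ltW.
have {}hc : `|c| <= e1 * n by apply: le_trans hc _; rewrite ler_wpM2l // ltW.
have {}hs : `|s| <= e1 * n by apply: le_trans hs _; rewrite ler_wpM2l // ltW.
have -> : expR a * cos b - 1 - a = E + expR a * c by rewrite /E /c; ring.
have -> : expR a * sin b - b = expR a * s + (E + a) * b by rewrite /E /s; ring.
have n1 : n <= 1 by rewrite ltW // (lt_le_trans he).
have e1n : e1 * n <= n by rewrite ler_piMl.
have ex3 : `|expR a| <= 3.
  have -> : expR a = 1 + a + E by rewrite /E; ring.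
  apply: le_trans (ler_normD _ _) _; apply: le_trans (lerD (ler_normD _ _) (lexx _)) _.
  by rewrite normr1; lra.
have b1 : `|expR a * c| <= 3 * (e1 * n) by rewrite normrM ler_pM.
have b2 : `|expR a * s| <= 3 * (e1 * n) by rewrite normrM ler_pM.
have b3 : `|(E + a) * b| <= 2 * (e1 * n).
  rewrite normrM.
  have : `|E + a| <= 2 * e1 by apply: le_trans (ler_normD _ _) _; have := le_lt_trans re he; lra.
  by move=> /(ler_pM (normr_ge0 _) (normr_ge0 _)) /(_ im); rewrite mulrA.
have e9 : e1 * n <= (e / 9) * n by rewrite ler_wpM2r.
have t1 := ler_normD E (expR a * c); have t2 := ler_normD (expR a * s) ((E + a) * b).
lra.
Qed.

(** The principal logarithm, on the right half-plane only. *)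
Definition clog (z : C) : C := ln (normc z) +i* atan (complex.Im z / complex.Re z).

Lemma cexp_clog z : 0 < complex.Re z -> cexp (clog z) = z.
Proof.
move=> z0; have n0 : 0 < normc z.
  by apply: lt_le_trans z0 _; apply: le_trans (Re_le_normc z); exact: ler_norm.
rewrite /cexp /clog /= lnK ?posrE //; set t := complex.Im z / complex.Re z.
have cE : cos (atan t) = complex.Re z / normc z.
  rewrite cos_atan; rewrite /t; case: (z) z0 n0 => a b /= a0 n0.
  have -> : 1 + (b / a) ^+ 2 = (a ^+ 2 + b ^+ 2) / a ^+ 2 by field; rewrite gt_eqF.
  by rewrite sqrtrM ?addr_ge0 ?sqr_ge0 // sqrtrV ?sqr_ge0 // sqrtr_sqr gtr0_norm // invfM invrK mulrC.
have c0 : cos (atan t) != 0 by rewrite cE gt_eqF // divr_gt0.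
have sE : sin (atan t) = complex.Im z / normc z.
  have := atanK t; rewrite /tan => e; rewrite -[LHS](divfK c0) e cE /t.
  by field; rewrite !gt_eqF.
rewrite cE sE; case: (z) z0 n0 => a b /= a0 n0.
by apply/eqP; rewrite eq_complex /=; apply/andP; split; apply/eqP; field; rewrite gt_eqF.
Qed.

Lemma near_real_continuous (u : C -> R) z :
  (forall h, `|u (z + h) - u z| <= normc h) -> {for z, continuous u}.
Proof.
move=> H; apply/(@cvgrPdist_lt _ _ _ (nbhs z) (nbhs_filter z)) => e e0.
apply/nbhs_normcP; exists e => // h he.
by rewrite distrC; apply: le_lt_trans (H h) he.
Qed.

Lemma clog_continuous z : 0 < complex.Re z -> {for z, continuous clog}.
Proof.
move=> z0; have n0 : 0 < normc z.
  by apply: lt_le_trans z0 _; apply: le_trans (Re_le_normc z); exact: ler_norm.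
have cn : {for z, continuous (@normc R : C -> R)}.
  apply: near_real_continuous => h; rewrite ler_norml; apply/andP; split.
    rewrite lerBrDr addrC lerBlDr -(normcN h) -{1}(addrK h z); exact: le_normcD.
  by rewrite lerBlDl le_normcD.
have cr : {for z, continuous (@complex.Re R : C -> R)}.
  by apply: near_real_continuous => h; rewrite raddfD /= addrAC subrr add0r Re_le_normc.
have ci : {for z, continuous (@complex.Im R : C -> R)}.
  by apply: near_real_continuous => h; rewrite raddfD /= addrAC subrr add0r Im_le_normc.
have c1 : {for z, continuous ((@ln R) \o (@normc R : C -> R))}.
  by apply: continuous_comp => //; exact: continuous_ln.
have c2 : {for z, continuous ((@atan R) \o (fun z : C => complex.Im z / complex.Re z))}.
  apply: continuous_comp; last exact: continuous_atan.
  have rn : complex.Re z != 0 by rewrite gt_eqF.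
  have cv := @cvgV R C (nbhs z) (nbhs_filter z) _ _ rn cr.
  exact: (@cvgM R C (nbhs z) (nbhs_filter z) _ _ _ _ ci cv).
apply/continuous_normcP => e e0; have e2 : 0 < e / 2 by rewrite divr_gt0.
have /cvgrPdist_lt /(_ _ e2) /nbhs_normcP [d1 d10 H1] := c1.
have /cvgrPdist_lt /(_ _ e2) /nbhs_normcP [d2 d20 H2] := c2.
exists (Num.min d1 d2); first by rewrite lt_min d10.
move=> h; rewrite lt_min => /andP[h1 h2]; apply: le_lt_trans (normc_le _) _.
rewrite [e]splitr; apply: ltrD; rewrite /= distrC; [exact: H1|exact: H2].
Qed.

(** Inverse function rule: the increment [k] of the logarithm satisfies
[h / z = cexp k - 1], and it is small by continuity. *)
Lemma is_derive_clog z : 0 < complex.Re z -> is_derive z (1 : C) clog z^-1.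
Proof.
move=> z0; have zn0 : z != 0 by apply: contraTneq z0 => ->; rewrite /= ltxx.
have n0 : 0 < normc z.
  by apply: lt_le_trans z0 _; apply: le_trans (Re_le_normc z); exact: ler_norm.
apply/is_derive_normcP => e e0.
pose e1 := Num.min (2^-1) (e * normc z / 2).
have e10 : 0 < e1 by rewrite lt_min invr_gt0 ltr0n divr_gt0 // mulr_gt0.
have [d1 d10 H1] := (is_derive_normcP _ _ _).1 (is_derive_cexp 0) _ e10.
have [d2 d20 H2] := (continuous_normcP _ _).1 (clog_continuous z0) _ d10.
exists (Num.min d2 (complex.Re z)); first by rewrite lt_min d20.
move=> h; rewrite lt_min => /andP[h2 hz].
have zh : 0 < complex.Re (z + h).
  by have := le_lt_trans (Re_le_normc h) hz; rewrite raddfD /= ltr_norml => /andP[]; lra.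
set k := clog (z + h) - clog z.
have hk : z + h = z * cexp k by rewrite -{2}(cexp_clog z0) -cexpD [clog z + k]addrC subrK cexp_clog.
have := H1 k (H2 h h2); rewrite add0r cexp0 mulr1 => k1.
have hE : h / z = cexp k - 1 by rewrite -[h](addKr z) hk; field.
have {}k1 : normc (k - h * z^-1) <= e1 * normc k.
  by rewrite hE -normcN; move: k1; congr (normc _ <= _); ring.
have e12 : e1 <= 2^-1 by rewrite ge_min lexx.
have e13 : e1 <= e * normc z / 2 by rewrite ge_min lexx orbT.
have kb : normc k <= 2 * normc (h / z).
  have : normc k <= normc (k - h / z) + normc (h / z) by rewrite -{1}(subrK (h / z) k) le_normcD.
  have : e1 * normc k <= 2^-1 * normc k by rewrite ler_wpM2r ?normc_ge0.
  move: k1; lra.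
apply: le_trans k1 _; apply: le_trans (ler_pM (ltW e10) (normc_ge0 _) e13 kb) _.
rewrite normcM normcV le_eqVlt; apply/orP; left; apply/eqP; field.
by rewrite gt_eqF.
Qed.

End ExpLog.

(** * Complex power series *)

Section PowerSeries.
Variable R : realType.
Local Notation C := (R[i]^o).
Implicit Types (x z w h l : C) (a b : nat -> C).

Lemma normcX z n : normc (z ^+ n) = normc z ^+ n.
Proof. by elim: n => [|n IH]; rewrite ?expr0 ?normc1 // !exprS normcM IH. Qed.

Lemma normc_nat n : normc (n%:R : C) = n%:R.
Proof. by rewrite -[n%:R](rmorph_nat (real_complex R)) /= expr0n /= addr0 sqrtr_sqr ger0_norm. Qed.

Lemma normc_sum n (F : 'I_n -> C) : normc (\sum_(i < n) F i) <= \sum_(i < n) normc (F i).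
Proof.
elim: n F => [|n IH] F; first by rewrite !big_ord0 normc0.
by rewrite !big_ord_recr /=; apply: le_trans (le_normcD _ _) _; rewrite lerD2r IH.
Qed.

Definition psum a z N := \sum_(i < N) a i * z ^+ i.

Definition psum_lim a z l := forall e : R, 0 < e -> exists N0, forall N, (N0 <= N)%N ->
  normc (psum a z N - l) <= e.

Lemma psum_lim_le a z l (B : R) (b : C) : (forall N, normc (psum a z N + b) <= B) ->
  psum_lim a z l -> normc (l + b) <= B.
Proof.
move=> H L; apply/ler_addgt0Pr => e e0; have [N0 /(_ _ (leqnn _)) HN] := L e e0.
have -> : l + b = (psum a z N0 + b) - (psum a z N0 - l) by ring.
by apply: le_trans (le_normcD _ _) _; rewrite normcN lerD.
Qed.

Lemma psum_limD a b z l m : psum_lim a z l -> psum_lim b z m ->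
  psum_lim (fun n => a n + b n) z (l + m).
Proof.
move=> La Lb e e0; have e2 : 0 < e / 2 by rewrite divr_gt0.
have [N1 H1] := La _ e2; have [N2 H2] := Lb _ e2.
exists (maxn N1 N2) => N; rewrite geq_max => /andP[/H1 h1 /H2 h2].
have -> : psum (fun n => a n + b n) z N - (l + m) = (psum a z N - l) + (psum b z N - m).
  rewrite /psum (eq_bigr (fun i : 'I_N => a i * z ^+ i + b i * z ^+ i)) ?big_split /=; first by ring.
  by move=> i _; rewrite mulrDl.
by apply: le_trans (le_normcD _ _) _; rewrite [e]splitr lerD.
Qed.

Lemma psum_limZ a z l (k : C) : psum_lim a z l -> psum_lim (fun n => k * a n) z (k * l).
Proof.
move=> La e e0; have k0 : 0 < 1 + normc k by rewrite ltr_pwDl ?normc_ge0.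
have [|N1 H1] := La (e / (1 + normc k)); first by rewrite divr_gt0.
exists N1 => N /H1 h1.
have -> : psum (fun n => k * a n) z N - k * l = k * (psum a z N - l).
  rewrite mulrBr /psum mulr_sumr; congr (_ - _); apply: eq_bigr => i _; by rewrite mulrA.
rewrite normcM; apply: le_trans (ler_wpM2l (normc_ge0 _) h1) _.
by rewrite mulrCA ler_piMr ?(ltW e0) // ler_pdivrMr // mul1r lerDr.
Qed.

Lemma psum_limS a z l : psum_lim (fun n => a n.+1) z l -> psum_lim a z (a 0%N + z * l).
Proof.
move=> La e e0; have k0 : 0 < 1 + normc z by rewrite ltr_pwDl ?normc_ge0.
have [|N1 H1] := La (e / (1 + normc z)); first by rewrite divr_gt0.
exists N1.+1 => -[//|N]; rewrite ltnS => /H1 h1.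
have -> : psum a z N.+1 - (a 0%N + z * l) = z * (psum (fun n => a n.+1) z N - l).
  rewrite /psum big_ord_recl /= expr0 mulr1 mulrBr mulr_sumr opprD addrACA subrr add0r.
  congr (_ - _); apply: eq_bigr => i _; rewrite /bump /= add1n exprS; ring.
rewrite normcM; apply: le_trans (ler_wpM2l (normc_ge0 _) h1) _.
by rewrite mulrCA ler_piMr ?(ltW e0) // ler_pdivrMr // mul1r lerDr.
Qed.

Lemma psum_lim_zero a z l : (forall n, a n = 0) -> psum_lim a z l -> l = 0.
Proof.
move=> a0 La; apply: eq0_normc; apply/eqP; rewrite eq_le normc_ge0 andbT.
rewrite -[l]addr0; apply: psum_lim_le La => N.
by rewrite addr0 /psum big1 ?normc0 // => i _; rewrite a0 mul0r.
Qed.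

(** Taking the limit in both components reduces the convergence to real series. *)
Definition csum a z : C :=
  (limn (fun N => complex.Re (psum a z N))) +i* (limn (fun N => complex.Im (psum a z N))).

Lemma cvg_dominated (u : nat -> R) (M q : R) : 0 <= q < 1 -> 
  (forall n, `|u n| <= M * q ^+ n) -> cvgn (series u).
Proof.
move=> /andP[q0 q1] H; apply: normed_cvg.
apply: (@series_le_cvg _ _ (geometric M q)) => //.
- by move=> n /=.
- by move=> n /=; apply: le_trans (H n).
by apply: is_cvg_geometric_series; rewrite ger0_norm.
Qed.

Lemma csumP a (M K : R) z : 0 < K -> 0 <= M -> (forall n, normc (a n) <= M * K ^+ n) -> 8 * (K * normc z) < 1 ->
  psum_lim a z (csum a z).
Proof.
move=> K0 M0 H hz.
have q1 : 0 <= K * normc z < 1.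
  by have := mulr_ge0 (ltW K0) (normc_ge0 z) => ?; apply/andP; split=> //; lra.
have bd n : normc (a n * z ^+ n) <= M * (K * normc z) ^+ n.
  by rewrite normcM normcX exprMn mulrA ler_wpM2r ?exprn_ge0 ?normc_ge0.
have cR : cvgn (fun N => complex.Re (psum a z N)).
  have -> : (fun N => complex.Re (psum a z N)) = series (fun n => complex.Re (a n * z ^+ n)).
    by apply/funext => N; rewrite /series /= big_mkord /psum raddf_sum.
  apply: (cvg_dominated q1) => n; apply: le_trans (bd n); exact: Re_le_normc.
have cI : cvgn (fun N => complex.Im (psum a z N)).
  have -> : (fun N => complex.Im (psum a z N)) = series (fun n => complex.Im (a n * z ^+ n)).
    by apply/funext => N; rewrite /series /= big_mkord /psum raddf_sum.
  apply: (cvg_dominated q1) => n; apply: le_trans (bd n); exact: Im_le_normc.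
move=> e e0; have e2 : 0 < e / 2 by rewrite divr_gt0.
have /cvgrPdist_le /(_ _ e2) [N1 _ H1] := cR.
have /cvgrPdist_le /(_ _ e2) [N2 _ H2] := cI.
exists (maxn N1 N2) => N; rewrite geq_max => /andP[/H1 h1 /H2 h2].
apply: le_trans (normc_le _) _; rewrite [e]splitr !raddfB /=.
by apply: lerD; rewrite distrC.
Qed.

Definition dcoef a n : C := n.+1%:R * a n.+1.

Lemma dcoef_bound a (M K : R) : 0 < K -> 0 <= M -> (forall n, normc (a n) <= M * K ^+ n) ->
  forall n, normc (dcoef a n) <= (M * K) * (2 * K) ^+ n.
Proof.
move=> K0 M0 H n; rewrite /dcoef normcM normc_nat.
have h : n.+1%:R <= 2 ^+ n :> R by rewrite -natrX ler_nat ltn_expl.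
apply: le_trans (ler_pM _ (normc_ge0 _) h (H n.+1)) _; first by rewrite ler0n.
by rewrite exprMn exprS le_eqVlt; apply/orP; left; apply/eqP; ring.
Qed.

(** The factors [r] and [r ^+ 2] stand for the negative powers of [r] in the usual
estimates. *)
Lemma pow_taylor z h (r : R) n : normc z <= r -> normc (z + h) <= r ->
  r * normc ((z + h) ^+ n - z ^+ n) <= n%:R * normc h * r ^+ n /\
  r ^+ 2 * normc ((z + h) ^+ n.+1 - z ^+ n.+1 - h * (n.+1%:R * z ^+ n)) <= n.+1%:R ^+ 2 * normc h ^+ 2 * r ^+ n.+1.
Proof.
move=> hz hzh; have r0 : 0 <= r by apply: le_trans hz; exact: normc_ge0.
have h0 := normc_ge0 h.
have S1 m : r * normc ((z + h) ^+ m - z ^+ m) <= m%:R * normc h * r ^+ m.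
  elim: m => [|m IH]; first by rewrite !expr0 subrr normc0 mulr0 mul0r mul0r.
  have -> : (z + h) ^+ m.+1 - z ^+ m.+1 = z * ((z + h) ^+ m - z ^+ m) + h * (z + h) ^+ m.
    by rewrite !exprS; ring.
  apply: le_trans (ler_wpM2l r0 (le_normcD _ _)) _; rewrite !normcM normcX mulrDr.
  have t1 : r * (normc z * normc ((z + h) ^+ m - z ^+ m)) <= r * (m%:R * normc h * r ^+ m).
    rewrite mulrCA; apply: ler_pM => //; rewrite ?mulr_ge0 ?normc_ge0 //.
  have t2 : r * (normc h * normc (z + h) ^+ m) <= r * (normc h * r ^+ m).
    by rewrite !ler_wpM2l // lerXn2r ?nnegrE ?normc_ge0.
  apply: le_trans (lerD t1 t2) _; rewrite exprS -[m.+1%:R]natr1 le_eqVlt.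
  by apply/orP; left; apply/eqP; ring.
split=> //; elim: n => [|n IH].
  have -> : (z + h) ^+ 1 - z ^+ 1 - h * (1%:R * z ^+ 0) = 0 by rewrite !expr1 expr0; ring.
  rewrite normc0 mulr0.
  by rewrite !mulr_ge0 ?exprn_ge0.
have -> : (z + h) ^+ n.+2 - z ^+ n.+2 - h * (n.+2%:R * z ^+ n.+1) =
   z * ((z + h) ^+ n.+1 - z ^+ n.+1 - h * (n.+1%:R * z ^+ n)) + h * ((z + h) ^+ n.+1 - z ^+ n.+1).
  by rewrite -[n.+2%:R]natr1 !exprS; ring.
apply: le_trans (ler_wpM2l (exprn_ge0 2 r0) (le_normcD _ _)) _; rewrite !normcM mulrDr.
set E := normc (_ - h * _) in IH *; set D := normc (_ - _).
have t1 : r ^+ 2 * (normc z * E) <= r * (n.+1%:R ^+ 2 * normc h ^+ 2 * r ^+ n.+1).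
  by rewrite mulrCA; apply: ler_pM => //; rewrite ?mulr_ge0 ?exprn_ge0 ?normc_ge0.
have t2 : r ^+ 2 * (normc h * D) <= r * normc h * (n.+1%:R * normc h * r ^+ n.+1).
  have -> : r ^+ 2 * (normc h * D) = r * normc h * (r * D) by ring.
  by rewrite ler_wpM2l ?mulr_ge0 //; exact: S1.
apply: le_trans (lerD t1 t2) _.
have -> : r * (n.+1%:R ^+ 2 * normc h ^+ 2 * r ^+ n.+1) + r * normc h * (n.+1%:R * normc h * r ^+ n.+1) =
  (n.+1%:R ^+ 2 + n.+1%:R) * (normc h ^+ 2 * r ^+ n.+2) by rewrite [r ^+ n.+2]exprS; ring.
rewrite -[leRHS]mulrA; apply: ler_wpM2r; first by apply: mulr_ge0; apply: exprn_ge0.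
rewrite -[n.+2%:R]natr1; have : 0 <= n.+1%:R :> R by []; move: (n.+1%:R) => m m0; nra.
Qed.

(** The first-order Taylor remainders of the partial sums are bounded by
[B |h|^2] with [B] independent of the partial sum, so the bound passes to the
limit. *)
Lemma is_derive_csum a (M K : R) z : 0 < K -> 0 <= M -> (forall n, normc (a n) <= M * K ^+ n) ->
  16 * (K * normc z) < 1 ->
  is_derive z (1 : C) (csum a) (csum (dcoef a) z).
Proof.
move=> K0 M0 H hz.
(* On the disc of radius [r] the bound [n^2 (K r)^n <= 2^-n] holds. *)
pose r := (8 * K)^-1.
have r0 : 0 < r by rewrite invr_gt0 mulr_gt0.
have rz : normc z < r.
  by rewrite -[r]mul1r ltr_pdivlMr ?mulr_gt0 //; have := normc_ge0 z; nra.
have K2 : 0 < 2 * K by rewrite mulr_gt0.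
have MK0 : 0 <= M * K by rewrite mulr_ge0 // ltW.
have Ld := csumP K2 MK0 (dcoef_bound K0 M0 H) (_ : 8 * (2 * K * normc z) < 1).
have {}Ld : psum_lim (dcoef a) z (csum (dcoef a) z) by apply: Ld; lra.
have rK y : normc y < r -> psum_lim a y (csum a y).
  move=> hy; apply: (csumP K0 M0 H).
  by rewrite mulrA -ltr_pdivlMl ?mulr_gt0 // mulr1.
pose B := 2 * M / r ^+ 2.
have quad h : normc h < r - normc z -> normc (csum a (z + h) - csum a z - h * csum (dcoef a) z) <= B * normc h ^+ 2.
  move=> hh; have rzh : normc (z + h) < r by apply: le_lt_trans (le_normcD _ _) _; lra.
  have fin N : normc (psum a (z + h) N.+1 - psum a z N.+1 - h * psum (dcoef a) z N) <= B * normc h ^+ 2.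
    have -> : psum a (z + h) N.+1 - psum a z N.+1 - h * psum (dcoef a) z N =
      \sum_(i < N) a i.+1 * ((z + h) ^+ i.+1 - z ^+ i.+1 - h * (i.+1%:R * z ^+ i)).
      rewrite /psum !big_ord_recl /= !expr0 opprD addrACA subrr add0r -sumrB mulr_sumr -sumrB.
      by apply: eq_bigr => i _; rewrite /bump /= add1n /dcoef; ring.
    apply: le_trans (normc_sum _) _.
    have each (i : nat) : normc (a i.+1 * ((z + h) ^+ i.+1 - z ^+ i.+1 - h * (i.+1%:R * z ^+ i))) <=
        (M / r ^+ 2 * normc h ^+ 2) * 2^-1 ^+ i.+1.
      have [_ T] := pow_taylor i (ltW rz) (ltW rzh).
      rewrite normcM; set E := normc (_ - h * _) in T *.
      have r20 : 0 < r ^+ 2 by rewrite exprn_gt0.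
      rewrite -(ler_pM2l r20).
      have -> : r ^+ 2 * (M / r ^+ 2 * normc h ^+ 2 * 2^-1 ^+ i.+1) = M * (normc h ^+ 2 * 2^-1 ^+ i.+1).
        by field; rewrite gt_eqF.
      rewrite mulrCA; apply: le_trans (ler_pM (normc_ge0 _) _ (H i.+1) T) _.
        by rewrite mulr_ge0 ?normc_ge0 // ltW.
      have -> : M * K ^+ i.+1 * (i.+1%:R ^+ 2 * normc h ^+ 2 * r ^+ i.+1) =
          M * (normc h ^+ 2 * (i.+1%:R ^+ 2 * 8^-1 ^+ i.+1)).
        have -> : (8^-1 : R) = K * r by rewrite /r; field; rewrite gt_eqF.
        by rewrite exprMn; ring.
      apply: ler_wpM2l => //; apply: ler_wpM2l; first by apply: exprn_ge0; exact: normc_ge0.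
      have -> : (8^-1 : R) = 2^-1 * (2^-1 ^+ 2) by field.
      rewrite exprMn mulrCA ler_piMr ?exprn_ge0 ?invr_ge0 //.
      rewrite -exprM mulnC exprM -exprMn exprn_ile1 ?mulr_ge0 ?exprn_ge0 ?invr_ge0 //.
      by rewrite exprVn ler_pdivrMr ?exprn_gt0 // mul1r -natrX ler_nat ltnW // ltn_expl.
    have gs (k : R) : 0 <= k -> \sum_(i < N) k * 2^-1 ^+ i.+1 <= k.
      move=> k0; have -> : \sum_(i < N) k * 2^-1 ^+ i.+1 = k * (1 - 2^-1 ^+ N).
        elim: N => [|m IH]; first by rewrite big_ord0 expr0 subrr mulr0.
        by rewrite big_ord_recr /= IH exprS; field.
      by rewrite ler_piMr // gerBl exprn_ge0 // invr_ge0.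
    apply: (@le_trans _ _ (\sum_(i < N) (M / r ^+ 2 * normc h ^+ 2) * 2^-1 ^+ i.+1)).
      by apply: ler_sum => i _; exact: each.
    have kk : 0 <= M / r ^+ 2 * normc h ^+ 2 by rewrite !mulr_ge0 ?exprn_ge0 ?normc_ge0 // invr_ge0 exprn_ge0 // ltW.
    apply: le_trans (gs _ kk) _.
    have -> : B * normc h ^+ 2 = 2 * (M / r ^+ 2 * normc h ^+ 2) by rewrite /B; ring.
    by move: kk; set k := M / _ * _; lra.
  apply/ler_addgt0Pr => e e0.
  have e3 : 0 < e / 3 by rewrite divr_gt0.
  have e3h : 0 < e / 3 / (1 + normc h) by rewrite divr_gt0 // ltr_pwDl ?normc_ge0.
  have [N1 H1] := rK _ rzh _ e3; have [N2 H2] := rK _ rz _ e3; have [N3 H3] := Ld _ e3h.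
  pose N := maxn N1 (maxn N2 N3).
  have h1 : normc (psum a (z + h) N.+1 - csum a (z + h)) <= e / 3 by apply: H1; rewrite leqW // leq_maxl.
  have h2 : normc (psum a z N.+1 - csum a z) <= e / 3.
    by apply: H2; rewrite leqW // leq_max leq_maxl orbT.
  have h3 : normc (h * (psum (dcoef a) z N - csum (dcoef a) z)) <= e / 3.
    have h3 : normc (psum (dcoef a) z N - csum (dcoef a) z) <= e / 3 / (1 + normc h).
      by apply: H3; rewrite !leq_max leqnn !orbT.
    rewrite normcM; apply: le_trans (ler_wpM2l (normc_ge0 _) h3) _.
    by rewrite mulrCA ler_piMr ?(ltW e3) // ler_pdivrMr ?ltr_pwDl ?normc_ge0 // mul1r lerDr.
  have alg (p1 p2 p3 c1 c2 c3 k : C) : c1 - c2 - k * c3 =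
    (p1 - p2 - k * p3) + (- (p1 - c1) + ((p2 - c2) + k * (p3 - c3))) by ring.
  rewrite (alg (psum a (z + h) N.+1) (psum a z N.+1) (psum (dcoef a) z N)).
  apply: le_trans (le_normcD _ _) _; apply: lerD (fin N) _.
  apply: le_trans (le_normcD _ _) _; rewrite normcN.
  apply: le_trans (lerD h1 (le_normcD _ _)) _; apply: le_trans (lerD (lexx _) (lerD h2 h3)) _.
  by rewrite le_eqVlt; apply/orP; left; apply/eqP; field.
apply/is_derive_normcP => e e0.
have B0 : 0 < 1 + B.
  by rewrite ltr_pwDl // /B !mulr_ge0 // invr_ge0 exprn_ge0 // ltW.
exists (Num.min (r - normc z) (e / (1 + B))).
  by rewrite lt_min subr_gt0 rz divr_gt0.
move=> h; rewrite lt_min => /andP[h1 h2]; apply: le_trans (quad h h1) _.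
rewrite expr2 mulrA ler_wpM2r ?normc_ge0 //.
have hn := normc_ge0 h; move: h2; rewrite ltr_pdivlMr // mulrDr mulr1 => h2.
by rewrite mulrC; lra.
Qed.

End PowerSeries.

(** * The hypergeometric series *)

Section Frobenius.
Variable R : realType.
Local Notation C := (R[i]^o).
Implicit Types (x z w h l A B c : C).

Lemma psum_lim_unique (a : nat -> C) z l m : psum_lim a z l -> psum_lim a z m -> l = m.
Proof.
move=> L1 L2; have := psum_limD L1 (psum_limZ (-1) L2).
move=> /psum_lim_zero h; apply/eqP; rewrite -subr_eq0 -mulN1r; apply/eqP; apply: h => n; ring.
Qed.

Fixpoint hcoef A B c n : C := if n is m.+1 then
  hcoef A B c m * ((m%:R + A) * (m%:R + B) / (m.+1%:R * (m%:R + c))) else 1.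

Lemma normc_ge_Re z : complex.Re z <= normc z.
Proof. by apply: le_trans (Re_le_normc z); exact: ler_norm. Qed.

Lemma Re_nat_add m c : complex.Re (m%:R + c) = m%:R + complex.Re c.
Proof. by rewrite raddfD /= -[m%:R in LHS](rmorph_nat (real_complex R)). Qed.

Lemma hcoef_bound A B c : 2^-1 <= complex.Re c ->
  exists2 K : R, 0 < K & forall n, normc (hcoef A B c n) <= 1 * K ^+ n.
Proof.
move=> hc; have nA := normc_ge0 A; have nB := normc_ge0 B.
exists (2 * ((1 + normc A) * (1 + normc B))); first by rewrite !mulr_gt0 // ltr_pwDl.
have hm m (X : C) : normc (m%:R + X) <= m.+1%:R * (1 + normc X).
  apply: le_trans (le_normcD _ _) _; rewrite normc_nat -natr1.
  have : 0 <= m%:R :> R by []. have := normc_ge0 X; nra.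
elim=> [|m IH]; first by rewrite normc1 expr0 mulr1.
rewrite /= !normcM normcV normcM normc_nat exprSr [leRHS]mulrA.
apply: ler_pM => //; rewrite ?mulr_ge0 ?invr_ge0 ?mulr_ge0 ?normc_ge0 //.
have n0 : 0 < m.+1%:R :> R by rewrite ltr0n.
have hd : m.+1%:R / 2 <= normc (m%:R + c).
  by apply: le_trans (normc_ge_Re _); rewrite Re_nat_add -natr1; have : 0 <= m%:R :> R by []; lra.
have d0 : 0 < normc (m%:R + c) by apply: lt_le_trans hd; rewrite divr_gt0.
rewrite ler_pdivrMr ?mulr_gt0 //.
apply: le_trans (ler_pM (normc_ge0 _) (normc_ge0 _) (hm m A) (hm m B)) _.
set P := (1 + normc A) * (1 + normc B).
have -> : m.+1%:R * (1 + normc A) * (m.+1%:R * (1 + normc B)) = (2 * P * m.+1%:R) * (m.+1%:R / 2).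
  by rewrite /P; field.
by rewrite [leRHS]mulrA ler_wpM2l // !mulr_ge0 // addr_ge0.
Qed.

(** Multiplication by [z] shifts coefficients, so the left-hand side of the equation
is the sum of a power series, whose coefficients vanish by the recurrence
defining [hcoef]. *)
Lemma hypergeometric_series A B c : 2^-1 <= complex.Re c ->
  exists r : R, exists f f1 f2 : C -> C, [/\ 0 < r, f 0 = 1 &
    forall z, normc z < r -> [/\ is_derive z (1 : C) f (f1 z), is_derive z (1 : C) f1 (f2 z) &
      z * (1 - z) * f2 z + (c - (A + B + 1) * z) * f1 z - A * B * f z = 0]].
Proof.
move=> hc; have [K K0 HK] := hcoef_bound A B hc.
set a := hcoef A B c in HK.
have K20 : 0 < 2 * K by rewrite mulr_gt0.
have K40 : 0 < 2 * (2 * K) by rewrite mulr_gt0.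
have M1 : 0 <= 1 * K by rewrite mul1r ltW.
have M2 : 0 <= 1 * K * (2 * K) by rewrite mulr_ge0 // ltW.
have H1 := dcoef_bound K0 ler01 HK.
have H2 := dcoef_bound K20 M1 H1.
exists (64 * K)^-1, (csum a), (csum (dcoef a)), (csum (dcoef (dcoef a))); split.
- by rewrite invr_gt0 mulr_gt0.
- have L0 : psum_lim a 0 (csum a 0).
    by apply: (csumP K0 ler01 HK); rewrite normc0 !mulr0.
  apply: psum_lim_unique L0 _ => e e0; exists 1%N => -[//|N] _.
  rewrite /psum big_ord_recl /= expr0 mul1r big1 ?addr0 ?subrr ?normc0 ?(ltW e0) //.
  by move=> i _; rewrite /bump /= add1n expr0n mulr0.
move=> z hz.
have {}hz : K * normc z < 64^-1.
  have : normc z * (64 * K) < 1 by rewrite -ltr_pdivlMr ?mulr_gt0 // mul1r.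
  by move: (normc z) => n; lra.
split.
- by apply: (is_derive_csum K0 ler01 HK); move: (normc z) hz => n; lra.
- by apply: (is_derive_csum K20 M1 H1); move: (normc z) hz => n; lra.
have L0 : psum_lim a z (csum a z) by apply: (csumP K0 ler01 HK); move: (normc z) hz => n; lra.
have L1 : psum_lim (dcoef a) z (csum (dcoef a) z).
  by apply: (csumP K20 M1 H1); move: (normc z) hz => n; lra.
have L2 : psum_lim (dcoef (dcoef a)) z (csum (dcoef (dcoef a)) z).
  by apply: (csumP K40 M2 H2); move: (normc z) hz => n; lra.
pose sh (b : nat -> C) n := if n is m.+1 then b m else 0.
have Lsh b l : psum_lim b z l -> psum_lim (sh b) z (z * l).
  by move=> L; rewrite -[z * l]add0r; apply: (@psum_limS _ (sh b)).
have L := psum_limD (psum_limD (psum_limD (Lsh _ _ L2) (psum_limZ (-1) (Lsh _ _ (Lsh _ _ L2))))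
  (psum_limD (psum_limZ c L1) (psum_limZ (- (A + B + 1)) (Lsh _ _ L1)))) (psum_limZ (- (A * B)) L0).
have alg (f f1 f2 : C) : z * (1 - z) * f2 + (c - (A + B + 1) * z) * f1 - A * B * f =
  z * f2 + -1 * (z * (z * f2)) + (c * f1 + - (A + B + 1) * (z * f1)) + - (A * B) * f by ring.
rewrite alg; apply: psum_lim_zero L => n.
have nz m : m%:R + c != 0.
  have h : 0 < complex.Re (m%:R + c) by rewrite Re_nat_add; have : 0 <= m%:R :> R by []; lra.
  by apply: contraTneq h => ->; rewrite /= ltxx.
have rec m : m.+1%:R * (m%:R + c) * a m.+1 = (m%:R + A) * (m%:R + B) * a m.
  by rewrite /a /=; field; rewrite nz addrC natr1 pnatr_eq0.
case: n => [|[|n]]; rewrite /sh /dcoef.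
- by have := rec 0%N; rewrite mul1r !add0r mulr0 => e; rewrite mulr0 addr0; transitivity (c * a 1%N - A * B * a 0%N); [ring|rewrite e; ring].
- have := rec 1%N => e; transitivity (2 * (1 + c) * a 2%N - (1 + A) * (1 + B) * a 1%N); first ring.
  by rewrite e; ring.
have := rec n.+2 => e.
transitivity (n.+3%:R * (n.+2%:R + c) * a n.+3 - (n.+2%:R + A) * (n.+2%:R + B) * a n.+2); last first.
  by rewrite e; ring.
by move: (a n.+3) (a n.+2) => p q; ring.
Qed.

End Frobenius.

(** * Two independent solutions near the origin *)

Section Pair.
Variable R : realType.
Local Notation C := (R[i]^o).
Implicit Types (x z w h l A B c mu : C).

Lemma open_nbhs_eq (U : set C) (f g : C -> C) x : open U -> U x -> (forall z, U z -> f z = g z) ->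
  \forall z \near x, f z = g z.
Proof. by move=> oU Ux fg; apply: filterS (open_nbhs_nbhs (conj oU Ux)). Qed.

Lemma derive1_on (U : set C) (y y1 y2 : C -> C) : open U ->
  (forall z, U z -> is_derive z (1 : C) y (y1 z) /\ is_derive z (1 : C) y1 (y2 z)) ->
  forall z, U z -> [/\ derive1 y z = y1 z, is_derive z (1 : C) (derive1 y) (y2 z) &
    derive1 (derive1 y) z = y2 z].
Proof.
move=> oU H z Uz; have [h1 h2] := H z Uz.
have e z' : U z' -> y1 z' = derive1 y z'.
  by move=> Uz'; have [h _] := H z' Uz'; rewrite (is_derive_derive1 h).
have h3 : is_derive z (1 : C) (derive1 y) (y2 z).
  by apply: is_derive_near h2; exact: open_nbhs_eq oU Uz e.
by split => //; [rewrite e|exact: is_derive_derive1 h3].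
Qed.

Lemma solution_intro (E : hypergeom R) (U : set C) (y y1 y2 : C -> C) : open U ->
  (forall z, U z -> is_derive z (1 : C) y (y1 z) /\ is_derive z (1 : C) y1 (y2 z)) ->
  (forall z, U z -> z * (1 - z) * y2 z + (parC E - (parA E + parB E + 1) * z) * y1 z - parA E * parB E * y z = 0) ->
  solution E U y.
Proof.
move=> oU H ode; split=> // z Uz; have [h1 _] := H z Uz.
have [e1 h2 e2] := derive1_on oU H Uz.
by split; [case: h1|case: h2|rewrite e1 e2; exact: ode].
Qed.

Definition half_disc (r : R) : set C := [set z | 0 < complex.Re z /\ normc z < r].

Lemma half_disc_open r : open (half_disc r).
Proof.
rewrite openE => z [z0 zr]; apply/nbhs_normcP.
exists (Num.min (complex.Re z) (r - normc z)); first by rewrite lt_min z0 subr_gt0.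
move=> h; rewrite lt_min => /andP[h1 h2]; split.
  by have := le_lt_trans (Re_le_normc h) h1; rewrite raddfD /= ltr_norml => /andP[]; lra.
by apply: le_lt_trans (le_normcD _ _) _; lra.
Qed.

Lemma is_derive_eqc (f : C -> C) x (df df' : C) : is_derive x (1 : C) f df -> df = df' ->
  is_derive x (1 : C) f df'.
Proof. by move=> h <-. Qed.

Lemma is_derive_inv z : z != 0 -> is_derive z (1 : C) (fun w : C => w^-1) (- z ^- 2).
Proof.
move=> z0; have h := @is_derive_id R[i] C z 1.
have dV := @derivableV R[i] C (fun w : C => w) z 1 z0 (@ex_derive _ _ _ _ _ _ _ h).
apply: DeriveDef; first exact: dV.
have := @deriveV R[i] C (fun w : C => w) z 1 z0 (@ex_derive _ _ _ _ _ _ _ h).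
have e : 'D_1 (fun w : C => w) z = (1 : C) := @derive_val _ _ _ _ _ _ _ h.
rewrite e => ->; exact: mulr1.
Qed.

Lemma is_derive_cpow mu z : 0 < complex.Re z ->
  is_derive z (1 : C) (fun w : C => cexp (mu * clog w)) (mu / z * cexp (mu * clog z)).
Proof.
move=> z0; exact: is_derive_compc (is_deriveZc mu (is_derive_clog z0)) (is_derive_cexp (mu * clog z)).
Qed.

Lemma Re_gt0_neq0 z : 0 < complex.Re z -> z != 0.
Proof. by move=> z0; apply: contraTneq z0 => ->; rewrite /= ltxx. Qed.

(** For an exponent [mu] at the origin, [z^mu f] solves the equation when [f] solves
the one with parameters [a + mu], [b + mu] and [c + 2 mu]. *)
Lemma frobenius (E : hypergeom R) mu (f f1 f2 : C -> C) (r : R) :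
  mu * (mu - 1) + parC E * mu = 0 ->
  (forall z, normc z < r -> [/\ is_derive z (1 : C) f (f1 z), is_derive z (1 : C) f1 (f2 z) &
      z * (1 - z) * f2 z + (parC E + 2 * mu - (parA E + mu + (parB E + mu) + 1) * z) * f1 z
        - (parA E + mu) * (parB E + mu) * f z = 0]) ->
  let y : C -> C := fun z => cexp (mu * clog z) * f z in
  solution E (half_disc r) y /\
  forall z, half_disc r z -> derive1 y z = cexp (mu * clog z) * (mu / z * f z + f1 z).
Proof.
move=> hmu Hf y.
pose y1 (z : C) : C := cexp (mu * clog z) * (mu / z * f z + f1 z).
pose y2 (z : C) : C := cexp (mu * clog z) * (mu / z * (mu / z * f z + f1 z) + (- mu / z ^+ 2 * f z + mu / z * f1 z + f2 z)).
have D z : half_disc r z -> is_derive z (1 : C) y (y1 z) /\ is_derive z (1 : C) y1 (y2 z).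
  move=> [z0 zr]; have [d1 d2 _] := Hf z zr; have zn0 := Re_gt0_neq0 z0; split.
    apply: is_derive_eqc (is_deriveMc (is_derive_cpow mu z0) d1) _.
    by rewrite /y1; ring.
  have dz := is_deriveZc mu (is_derive_inv zn0).
  apply: is_derive_eqc (is_deriveMc (is_derive_cpow mu z0) (is_deriveDc (is_deriveMc dz d1) d2)) _.
  by rewrite /y2; field.
split; last by move=> z Vz; have [-> _ _] := derive1_on (@half_disc_open r) D Vz.
apply: (solution_intro (@half_disc_open r) D) => z [z0 zr].
have [_ _ ode] := Hf z zr; have zn0 := Re_gt0_neq0 z0.
transitivity (cexp (mu * clog z) * (z * (1 - z) * f2 z + (parC E + 2 * mu - (parA E + mu + (parB E + mu) + 1) * z) * f1 z
        - (parA E + mu) * (parB E + mu) * f z + (mu * (mu - 1) + parC E * mu) * (1 / z * f z))).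
  by rewrite /y /y1 /y2; move: (cexp _) (f z) (f1 z) (f2 z) => t g g1 g2; field.
by rewrite ode hmu mul0r addr0 mulr0.
Qed.

(** The exponents at the origin are 0 and [1 - c]. Up to the factor [z^(- c)], the
Wronskian of the two Frobenius solutions is a continuous function [w] with
[w 0 = 1 - c]. *)
Lemma fundamental_pair (E : hypergeom R) :
  2^-1 <= complex.Re (parC E) -> complex.Re (parC E) <= 3 / 2 -> parC E != 1 ->
  exists2 r : R, 0 < r & exists ya yb : C -> C,
   [/\ solution E (half_disc r) ya, solution E (half_disc r) yb &
     forall z, half_disc r z -> ya z * derive1 yb z - derive1 ya z * yb z != 0].
Proof.
move=> c1 c2 cn1; set mu := 1 - parC E.
have mu0 : mu != 0 by rewrite subr_eq0 eq_sym.
have [r1 [f [f1 [f2 [r10 f0 Hf]]]]] := hypergeometric_series (parA E) (parB E) c1.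
have c1' : 2^-1 <= complex.Re (parC E + 2 * mu).
  have -> : parC E + 2 * mu = 2%:R + - parC E by rewrite /mu; ring.
  by rewrite Re_nat_add raddfN /=; lra.
have [r2 [k [k1 [k2 [r20 k0 Hk]]]]] := hypergeometric_series (parA E + mu) (parB E + mu) c1'.
pose w (z : C) : C := mu * (f z * k z) + z * (f z * k1 z + -1 * (f1 z * k z)).
have n0 (r : R) : 0 < r -> normc (0 : C) < r by rewrite normc0.
have cw : {for (0 : C), continuous w}.
  have [df df1 _] := Hf _ (n0 _ r10); have [dk dk1 _] := Hk _ (n0 _ r20).
  have := is_deriveDc (is_deriveZc mu (is_deriveMc df dk)) (is_deriveMc (is_derive_idc 0)
    (is_deriveDc (is_deriveMc df dk1) (is_deriveZc (-1) (is_deriveMc df1 dk)))).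
  exact: is_derive_continuous.
have w0 : w 0 = mu by rewrite /w f0 k0; ring.
have nmu : 0 < normc mu.
  by rewrite lt_neqAle normc_ge0 andbT eq_sym; apply: contra mu0 => /eqP /eq0_normc ->.
have [r3 r30 H3] := (continuous_normcP _ _).1 cw _ nmu.
pose r := Num.min r1 (Num.min r2 r3).
have r0 : 0 < r by rewrite !lt_min r10 r20.
exists r => //.
have rr z : normc z < r -> [/\ normc z < r1, normc z < r2 & normc z < r3].
  by rewrite !lt_min => /and3P[].
have [|z /rr[/Hf [h1 h2 h3] _ _]|sa da] := @frobenius E 0 f f1 f2 r _ _; first by rewrite mul0r mulr0 addr0.
  by split=> //; move: h3; rewrite mulr0 !addr0.
have [|z /rr[_ /Hk [h1 h2 h3] _]|sb db] := @frobenius E mu k k1 k2 r _ _; first by rewrite /mu; ring.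
  by split.
exists (fun z => cexp (0 * clog z) * f z), (fun z => cexp (mu * clog z) * k z); split => // z Vz.
have [z0 /rr[_ _ z3]] := Vz; have zn0 := Re_gt0_neq0 z0.
rewrite da // db // !mul0r cexp0 !mul1r add0r.
have wz : w z != 0.
  apply: contraTneq (H3 z z3); rewrite add0r w0 => ->.
  by rewrite sub0r normcN ltxx.
have -> : f z * (cexp (mu * clog z) * (mu / z * k z + k1 z)) - f1 z * (cexp (mu * clog z) * k z) =
   cexp (mu * clog z) * (w z / z).
  by rewrite /w; move: (cexp _) (f z) (f1 z) (k z) (k1 z) => t g g1 g2 g3; field.
by apply: mulf_neq0; [exact: cexp_neq0|apply: mulf_neq0 => //; exact: invr_neq0].
Qed.

End Pair.

(** * Branches of radical functions *)

Section Pullback.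
Variable R : realType.
Local Notation C := (R[i]^o).
Implicit Types (x z w h l : C) (p q P Q : {poly R[i]}).

Lemma is_derive_ext (f g : C -> C) x (df : C) : (forall z, f z = g z) ->
  is_derive x (1 : C) f df -> is_derive x (1 : C) g df.
Proof. by move=> /funext ->. Qed.

Lemma is_derive_horner p x : is_derive x (1 : C) (fun z : C => p.[z] : C) (p^`().[x] : C).
Proof.
elim/poly_ind: p => [|p c IH].
  rewrite deriv0 horner0; apply: is_derive_ext _ (is_derive_cstc 0 x).
  by move=> z; rewrite horner0.
apply: is_derive_ext _ (is_derive_eqc (is_deriveDc (is_deriveMc IH (is_derive_idc x)) (is_derive_cstc c x)) _).
  by move=> z; rewrite hornerMXaddC.
by rewrite derivMXaddC hornerD hornerM hornerX addr0 mulr1 addrC.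
Qed.

Lemma is_derive_quotient (f g : C -> C) x (df dg : C) : g x != 0 ->
  is_derive x (1 : C) f df -> is_derive x (1 : C) g dg ->
  is_derive x (1 : C) (fun z => f z / g z) ((df * g x - f x * dg) / g x ^+ 2).
Proof.
move=> g0 hf hg; have hi := is_derive_compc hg (is_derive_inv g0).
apply: is_derive_eqc (is_deriveMc hf hi) _.
by move: (g x) (f x) g0 => gx fx g0; field.
Qed.

Lemma is_derive_logd p x : p.[x] != 0 -> is_derive x (1 : C) (logd p : C -> C) (dlogd p x : C).
Proof.
move=> p0; apply: is_derive_eqc (is_derive_quotient p0 (is_derive_horner _ x) (is_derive_horner _ x)) _.
by rewrite /dlogd; move: (p.[x]) p0 (p^`().[x]) (p^`()^`().[x]) => a a0 b c; field.
Qed.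

Lemma is_derive_quot P Q x : Q.[x] != 0 ->
  is_derive x (1 : C) (quot P Q : C -> C) (quot1 P Q x : C) /\
  is_derive x (1 : C) (quot1 P Q : C -> C) (quot2 P Q x : C).
Proof.
move=> q0; split.
  apply: is_derive_eqc (is_derive_quotient q0 (is_derive_horner _ x) (is_derive_horner _ x)) _.
  by rewrite /quot1 /wronsk hornerD hornerN !hornerM.
have dQ := is_derive_horner Q x.
have qq0 : Q.[x] ^+ 2 != 0 by rewrite expf_neq0.
apply: is_derive_eqc (is_derive_quotient (g := fun z : C => Q.[z] ^+ 2) qq0 (is_derive_horner (wronsk P Q) x) _) _.
- exact: (is_deriveMc dQ dQ).
rewrite /quot2; move: (Q.[x]) q0 {qq0} ((wronsk P Q).[x]) (Q^`().[x]) ((wronsk P Q)^`().[x]) => a a0 b c d.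
by field.
Qed.

Lemma is_derive_sumc n (f : 'I_n -> C -> C) (df : 'I_n -> C) x :
  (forall i, is_derive x (1 : C) (f i) (df i)) ->
  is_derive x (1 : C) (fun z => \sum_(i < n) f i z) (\sum_(i < n) df i).
Proof.
elim: n f df => [|n IH] f df H.
  rewrite big_ord0; apply: is_derive_ext _ (is_derive_cstc 0 x).
  by move=> z; rewrite big_ord0.
rewrite big_ord_recl; apply: is_derive_ext _ (is_deriveDc (H ord0) (IH _ _ (fun i => H (lift ord0 i)))).
by move=> z; rewrite big_ord_recl.
Qed.

Lemma is_derive_prodc n (f : 'I_n -> C -> C) (df : 'I_n -> C) x :
  (forall i, is_derive x (1 : C) (f i) (f i x * df i)) ->
  is_derive x (1 : C) (fun z => \prod_(i < n) f i z) (\prod_(i < n) f i x * \sum_(i < n) df i).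
Proof.
elim: n f df => [|n IH] f df H.
  rewrite !big_ord0 mulr0; apply: is_derive_ext _ (is_derive_cstc 1 x).
  by move=> z; rewrite big_ord0.
rewrite !big_ord_recl.
apply: is_derive_ext _ (is_derive_eqc (is_deriveMc (H ord0) (IH _ _ (fun i => H (lift ord0 i)))) _).
  by move=> z; rewrite big_ord_recl.
by move: (f ord0 x) (\prod_i _) (\sum_i _) => a b c; ring.
Qed.

(** One of the rotations by 0, [pi] and [+- pi / 2] works. *)
Lemma half_plane_rotation w : w != 0 -> exists eta : C, 0 < complex.Re (cexp eta * w).
Proof.
move=> w0.
have cpi : cexp (0 +i* pi) = -1 :> C.
  by rewrite /cexp /= expR0 cospi sinpi; apply/eqP; rewrite eq_complex /= !(mul0r, mul1r, subr0, addr0, oppr0) !eqxx.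
have cpi2 : cexp (0 +i* (pi / 2)) = 0 +i* 1 :> C.
  by rewrite /cexp /= expR0 cos_pihalf sin_pihalf; apply/eqP; rewrite eq_complex /= !(mul0r, mul1r, mulr0, subr0, addr0, oppr0) !eqxx.
have cpi2N : cexp (0 +i* - (pi / 2)) = 0 +i* (-1) :> C.
  by rewrite /cexp /= expR0 cosN sinN cos_pihalf sin_pihalf; apply/eqP; rewrite eq_complex /= !(mul0r, mul1r, mulr0, subr0, addr0, oppr0) !eqxx.
have [h|h|h] := ltgtP (complex.Re w) 0.
- by exists (0 +i* pi); rewrite cpi mulN1r raddfN /= oppr_gt0.
- by exists 0; rewrite cexp0 mul1r.
have [k|k|k] := ltgtP (complex.Im w) 0.
- exists (0 +i* (pi / 2)); rewrite cpi2; case: (w) h k => a b /= _ k.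
  by rewrite mul0r mul1r sub0r oppr_gt0.
- exists (0 +i* - (pi / 2)); rewrite cpi2N; case: (w) h k => a b /= _ k.
  by rewrite mul0r mulN1r sub0r opprK.
by move: w0; rewrite eq_complex h k eqxx.
Qed.

(** The logarithmic derivative of the radical function, common to all its branches,
and the derivative of that rational function. *)
Definition theta_log (theta : radical R) (x : R[i]) : R[i] :=
  \sum_(i < rad_size theta) rad_expo theta i *
    (logd (rnum (rad_base theta i)) x + -1 * logd (rden (rad_base theta i)) x).
Definition theta_dlog (theta : radical R) (x : R[i]) : R[i] :=
  \sum_(i < rad_size theta) rad_expo theta i *
    (dlogd (rnum (rad_base theta i)) x + -1 * dlogd (rden (rad_base theta i)) x).

Lemma theta_ratpair theta : ratpair (theta_log theta) (theta_dlog theta).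
Proof.
apply: ratpair_sum => i; apply: ratpairZ; apply: ratpairD; first exact: ratpair_logd (rad_base_neq0 i).
apply: ratpairZ; exact: ratpair_logd (rden_neq0 _).
Qed.

Definition theta_regular (theta : radical R) (x : R[i]) :=
  forall i, (rnum (rad_base theta i)).[x] != 0 /\ (rden (rad_base theta i)).[x] != 0.

Lemma nbhs_neq0 (f : C -> C) x : {for x, continuous f} -> f x != 0 -> \forall z \near x, f z != 0.
Proof.
move=> cf f0; have n0 : 0 < normc (f x).
  by rewrite lt_neqAle normc_ge0 andbT eq_sym; apply: contra f0 => /eqP /eq0_normc ->.
have [d d0 Hd] := (continuous_normcP _ _).1 cf _ n0.
apply/nbhs_normcP; exists d => // h /Hd; apply: contraTneq => ->.
by rewrite sub0r normcN ltxx.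
Qed.

Lemma nbhs_Re_gt0 (f : C -> C) x : {for x, continuous f} -> 0 < complex.Re (f x) ->
  \forall z \near x, 0 < complex.Re (f z).
Proof.
move=> cf f0; have [d d0 Hd] := (continuous_normcP _ _).1 cf _ f0.
apply/nbhs_normcP; exists d => // h /Hd; set k := f (x + h) => hk.
by have := le_lt_trans (Re_le_normc _) hk; rewrite raddfB /= ltr_norml => /andP[]; lra.
Qed.

(** Each base is rotated into the right half-plane at [x], hence near [x], where the
principal logarithm provides a branch. *)
Lemma branch_exists (theta : radical R) (A : set C) x : theta_regular theta x -> nbhs x A ->
  exists U t, [/\ open U, U x, U `<=` A, radical_branch theta U t &
    forall z, U z -> [/\ t z != 0, is_derive z (1 : C) t (t z * theta_log theta z) &
      is_derive z (1 : C) (theta_log theta : C -> C) (theta_dlog theta z)]].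
Proof.
move=> reg nA.
pose n := rad_size theta.
have [eta Heta] : exists eta : 'I_n -> C, forall i, 0 < complex.Re (cexp (eta i) * reval (rad_base theta i) x).
  apply: (@fin_all_exists _ _ (fun i e => 0 < complex.Re (cexp e * reval (rad_base theta i) x))) => i.
  apply: half_plane_rotation; have [h1 h2] := reg i.
  by rewrite /reval; apply: mulf_neq0 => //; exact: invr_neq0.
pose good (i : 'I_n) : set C := [set z | [/\ (rnum (rad_base theta i)).[z] != 0, (rden (rad_base theta i)).[z] != 0 &
  0 < complex.Re (cexp (eta i) * reval (rad_base theta i) z)]].
have ngood : nbhs x (A `&` [set z | forall i, good i z]).
  apply: filterI => //; apply: (@filter_forall C 'I_n good (nbhs x) (nbhs_filter x)) => i.
  have [h1 h2] := reg i.
  have n1 := nbhs_neq0 (is_derive_continuous (is_derive_horner (rnum (rad_base theta i)) x)) h1.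
  have n2 := nbhs_neq0 (is_derive_continuous (is_derive_horner (rden (rad_base theta i)) x)) h2.
  have n3 : \forall z \near x, 0 < complex.Re (cexp (eta i) * reval (rad_base theta i) z).
    apply: (@nbhs_Re_gt0 (fun z : C => cexp (eta i) * reval (rad_base theta i) z) x _ (Heta i)).
    apply: (@is_derive_continuous _ (fun z : C => cexp (eta i) * reval (rad_base theta i) z)).
    exact: is_deriveZc (is_derive_quot _ h2).1.
  by apply: filterS3 n1 n2 n3 => z k1 k2 k3; split.
pose U := (A `&` [set z | forall i, good i z])^°.
have oU : open U by exact: open_interior.
have UA z : U z -> A z /\ forall i, good i z by move=> /interior_subset.
pose l (i : 'I_n) (z : C) : C := clog (cexp (eta i) * reval (rad_base theta i) z) - eta i.
have dl i z : U z -> cexp (l i z) = reval (rad_base theta i) z /\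
   is_derive z (1 : C) (l i) (logd (rnum (rad_base theta i)) z + -1 * logd (rden (rad_base theta i)) z : C).
  move=> /UA [_ /(_ i) [g1 g2 g3]]; split.
    by rewrite /l cexpD cexp_clog // mulrC mulrA -cexpD addrC subrr cexp0 mul1r.
  have dq := is_deriveZc (cexp (eta i)) (is_derive_quot (rnum (rad_base theta i)) g2).1.
  apply: is_derive_eqc (is_deriveDc (is_derive_compc dq (is_derive_clog g3)) (is_derive_cstc (- eta i) z)) _.
  rewrite mulN1r (logd_quot g1 g2).1 addr0.
  have e0 := cexp_neq0 (eta i).
  have q0 : quot (rnum (rad_base theta i)) (rden (rad_base theta i)) z != 0.
    by apply: mulf_neq0 => //; exact: invr_neq0.
  rewrite -[reval _ _]/(quot (rnum (rad_base theta i)) (rden (rad_base theta i)) z).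
  move: (cexp _) e0 (quot _ _ z) q0 (quot1 _ _ z) => a a0 b b0 c.
  by field; rewrite a0 b0.
pose t (z : C) : C := \prod_(i < n) cexp (rad_expo theta i * l i z).
exists U, t; split => //.
- by move=> z /UA [].
- exists l => // i z Uz; have [e [d _]] := dl i z Uz.
  by have [_ /(_ i) [_ g2 _]] := UA z Uz; split.
move=> z Uz; split.
- by apply/prodf_neq0 => i _; exact: cexp_neq0.
- apply: is_derive_prodc => i; have [_ d] := dl i z Uz.
  apply: is_derive_eqc (is_derive_compc (is_deriveZc (rad_expo theta i) d) (is_derive_cexp _)) _.
  by rewrite mulrC.
apply: is_derive_sumc => i; have [_ /(_ i) [g1 g2 _]] := UA z Uz.
exact: is_deriveZc (is_deriveDc (is_derive_logd g1) (is_deriveZc (-1) (is_derive_logd g2))).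
Qed.

End Pullback.

(** * The differential identities at a point *)

Section PullbackOde.
Variable R : realType.
Local Notation C := (R[i]^o).
Implicit Types (x z w h l : C) (p q P Q : {poly R[i]}).

(** The equation for [t * (y o phi)], with [y''] eliminated by means of the equation
for [y]; the values of [y], [y'] and [y''] at [phi x] are [y], [y1] and [y2]. *)
Lemma ode_eliminate (F : fieldType) (x a b c a' b' c' u u' f f1 f2 y y1 y2 t : F) :
  x != 0 -> 1 - x != 0 -> f != 0 -> 1 - f != 0 -> t != 0 ->
  f * (1 - f) * y2 + (c - (a + b + 1) * f) * y1 - a * b * y = 0 ->
  x * (1 - x) * (t * u * (u * y + f1 * y1) + t * (u' * y + u * (f1 * y1) + (f2 * y1 + f1 * (f1 * y2))))
    + (c' - (a' + b' + 1) * x) * (t * (u * y + f1 * y1)) - a' * b' * (t * y) = 0 ->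
  y * (u' + u ^+ 2 + (c' - (a' + b' + 1) * x) / (x * (1 - x)) * u + - (a' * b') / (x * (1 - x))
       - f1 ^+ 2 * (- (a * b) / (f * (1 - f))))
  + y1 * (2 * u * f1 + f2 + (c' - (a' + b' + 1) * x) / (x * (1 - x)) * f1
       - f1 ^+ 2 * ((c - (a + b + 1) * f) / (f * (1 - f)))) = 0.
Proof.
move=> x0 x1 f0 f10 t0 e1 e2.
have ey : y2 = (a * b * y - (c - (a + b + 1) * f) * y1) / (f * (1 - f)).
  apply: (@mulfI _ (f * (1 - f))); first by rewrite mulf_neq0.
  by rewrite [RHS]mulrC divfK ?mulf_neq0 // -[LHS]subr0 -e1; ring.
apply: (@mulfI _ (t * (x * (1 - x)))); first by rewrite !mulf_neq0.
rewrite mulr0 -[RHS]e2 ey; field.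
by rewrite x0 x1 f0 f10.
Qed.

Lemma derivable_is_derive (f : C -> C) x : derivable f x (1 : C) ->
  is_derive x (1 : C) f (derive1 f x).
Proof. by move=> h; apply: DeriveDef; [exact: h|rewrite derive1E]. Qed.

Lemma linear_system (F : fieldType) (y y1 w w1 p q : F) : y * w1 - y1 * w != 0 ->
  y * p + y1 * q = 0 -> w * p + w1 * q = 0 -> p = 0 /\ q = 0.
Proof.
move=> d0 e1 e2; split; apply: (mulfI d0); rewrite mulr0.
  transitivity (w1 * (y * p + y1 * q) - y1 * (w * p + w1 * q)); first ring.
  by rewrite e1 e2 !mulr0 subr0.
transitivity (y * (w * p + w1 * q) - w * (y * p + y1 * q)); first ring.
by rewrite e1 e2 !mulr0 subr0.
Qed.

(** Both solutions of the pair give a linear relation between the two coefficients;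
as their Wronskian does not vanish, the coefficients do. *)
Lemma pullback_ode_at (E E' : hypergeom R) (phi : ratfun R) (theta : radical R) (r : R) (ya yb : C -> C) x :
  pullback E E' phi theta ->
  solution E (half_disc r) ya -> solution E (half_disc r) yb ->
  (forall z, half_disc r z -> ya z * derive1 yb z - derive1 ya z * yb z != 0) ->
  theta_regular theta x -> (rden phi).[x] != 0 -> half_disc r (reval phi x) ->
  x != 0 -> 1 - x != 0 -> reval phi x != 0 -> 1 - reval phi x != 0 ->
  pullback_ode (parA E) (parB E) (parC E) (parA E') (parB E') (parC E')
    (rnum phi) (rden phi) (theta_log theta) (theta_dlog theta) x.
Proof.
move=> [_ pb] sa sb wr reg qx Vx x0 x1 f0 f10.
have [dphi _] := is_derive_quot (rnum phi) qx.
pose A : set C := [set z | (rden phi).[z] != 0 /\ half_disc r (reval phi z)].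
have nA : nbhs x A.
  apply: filterI; first exact: (nbhs_neq0 (is_derive_continuous (is_derive_horner (rden phi) x)) qx).
  have := is_derive_continuous dphi; apply.
  exact: (open_nbhs_nbhs (conj (@half_disc_open R r) Vx)).
have [U [t [oU Ux UA bt tD]]] := branch_exists reg nA.
have key (y : C -> C) : solution E (half_disc r) y ->
   y (reval phi x) * (theta_dlog theta x + theta_log theta x ^+ 2 + ode1 (parA E') (parB E') (parC E') x * theta_log theta x
     + ode0 (parA E') (parB E') x - quot1 (rnum phi) (rden phi) x ^+ 2 * ode0 (parA E) (parB E) (reval phi x))
   + derive1 y (reval phi x) * (2 * theta_log theta x * quot1 (rnum phi) (rden phi) x + quot2 (rnum phi) (rden phi) x
     + ode1 (parA E') (parB E') (parC E') x * quot1 (rnum phi) (rden phi) x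
     - quot1 (rnum phi) (rden phi) x ^+ 2 * ode1 (parA E) (parB E) (parC E) (reval phi x)) = 0.
  move=> sy.
  have [oU' S'] := pb _ y U t sy oU UA bt.
  pose f1 : C -> C := quot1 (rnum phi) (rden phi).
  pose f2 : C -> C := quot2 (rnum phi) (rden phi).
  pose u : C -> C := theta_log theta. pose u' : C -> C := theta_dlog theta.
  pose g : C -> C := reval phi.
  pose Y1 (z : C) : C := t z * (u z * y (g z) + f1 z * derive1 y (g z)).
  pose Y2 (z : C) : C := t z * u z * (u z * y (g z) + f1 z * derive1 y (g z))
    + t z * (u' z * y (g z) + u z * (f1 z * derive1 y (g z)) +
       (f2 z * derive1 y (g z) + f1 z * (f1 z * derive1 (derive1 y) (g z)))).
  have D z : U z -> is_derive z (1 : C) (fun z => t z * y (g z)) (Y1 z) /\ is_derive z (1 : C) Y1 (Y2 z).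
    move=> Uz; have [qz Vz] := UA z Uz; have [t0 dt du] := tD z Uz.
    have [dg df1] := is_derive_quot (rnum phi) qz.
    have [dy dy1 _] := sy.2 _ Vz.
    have hy := derivable_is_derive dy.
    have hy1 := derivable_is_derive dy1.
    have hyg := is_derive_compc dg hy; have hy1g := is_derive_compc dg hy1.
    split.
      by apply: is_derive_eqc (is_deriveMc dt hyg) _; rewrite /Y1 /f1 /u; ring.
    by apply: is_derive_eqc (is_deriveMc dt (is_deriveDc (is_deriveMc du hyg) (is_deriveMc df1 hy1g))) _.
  have [_ _ ode'] := S' x Ux.
  have [e1 _ e2] := derive1_on oU D Ux.
  rewrite e1 e2 in ode'.
  have [_ _ ode] := sy.2 _ Vx.
  have [t0 _ _] := tD x Ux.
  exact: (ode_eliminate x0 x1 f0 f10 t0 ode ode').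
have [k0 k1] := linear_system (wr _ Vx) (key _ sa) (key _ sb).
by split.
Qed.

Lemma injective_avoid (T : eqType) (f : nat -> T) (s : seq T) : injective f -> exists n, f n \notin s.
Proof.
move=> inj; apply: contrapT => /forallNP H.
have un : uniq (map f (iota 0 (size s).+1)) by rewrite map_inj_uniq ?iota_uniq.
have sub : {subset map f (iota 0 (size s).+1) <= s}.
  by move=> _ /mapP [k _ ->]; have /negP := H k; rewrite negbK.
by have := uniq_leq_size un sub; rewrite size_map size_iota ltnn.
Qed.

(** The polynomial [P - c Q] is constant for at most one value [c], so almost every
small positive real number [c] is a value of [P / Q]. *)
Lemma infinitely_preimage P Q (r : R) : coprimep P Q -> (1 < maxn (size P) (size Q))%N -> 0 < r ->
  infinitely (fun x : R[i] => Q.[x] != 0 /\ half_disc r (quot P Q x)).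
Proof.
move=> co sz r0 s.
pose f (n : nat) : R[i] := (r / n.+2%:R)%:C.
have finj : injective f.
  move=> m n /complexI /(mulfI (lt0r_neq0 r0)) /invr_inj /eqP; rewrite eqr_nat => /eqP [] //.
have [bad Hbad] : exists bad : R[i], forall c, c != bad -> (1 < size (P - c *: Q)%R)%N.
  have [[b hb]|H] := pselect (exists b, (size (P - b *: Q)%R <= 1)%N); last first.
    by exists 0 => c _; rewrite ltnNge; apply/negP => h; apply: H; exists c.
  exists b => c cb; rewrite ltnNge; apply/negP => hc.
  have sQ : (size Q <= 1)%N.
    rewrite -(size_scale Q (_ : c - b != 0)) ?subr_eq0 //.
    have -> : (c - b) *: Q = (P - b *: Q) - (P - c *: Q) by rewrite scalerBl; ring.
    by rewrite (leq_trans (size_polyD _ _)) // size_polyN geq_max hb.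
  have sP : (size P <= 1)%N.
    rewrite -(subrK (b *: Q) P) (leq_trans (size_polyD _ _)) // geq_max hb.
    by rewrite (leq_trans (size_scale_leq _ _)).
  by move: sz; rewrite ltnNge geq_max sP sQ.
have [n] := injective_avoid (bad :: [seq quot P Q x | x <- s]) finj.
rewrite inE negb_or => /andP[nb ns].
have /closed_rootP [x] : size (P - f n *: Q) != 1%N by rewrite gtn_eqF // Hbad.
rewrite /root !hornerE subr_eq0 => /eqP Px.
have qx : Q.[x] != 0.
  apply/negP => qx; have : root Q x by [].
  rewrite coprimep_sym in co; move=> /(coprimep_root co); rewrite Px (eqP qx) mulr0 eqxx.
  by [].
have fx : quot P Q x = f n by rewrite /quot Px mulfK.
exists x; last first.
  split=> //; rewrite fx /half_disc /f /=; have h : 0 < r / n.+2%:R by rewrite divr_gt0.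
  split=> //; rewrite expr0n /= addr0 sqrtr_sqr ger0_norm ?(ltW h) //.
  by rewrite ltr_pdivrMr // ltr_pMr // ltr1n.
by apply: contra ns => xs; rewrite -fx; apply/mapP; exists x.
Qed.

Lemma wronsk_neq0 P Q : coprimep P Q -> (1 < maxn (size P) (size Q))%N -> wronsk P Q != 0.
Proof.
move=> co sz; apply/negP => /eqP W0.
have cst (p q : {poly R[i]}) : p = 0 -> coprimep p q -> (maxn (size p) (size q) <= 1)%N.
  by move=> ->; rewrite coprime0p size_poly0 max0n => /eqp_size ->; rewrite size_poly1.
have P0 : P != 0 by apply: contraTneq sz => e; rewrite -leqNgt cst.
have Q0 : Q != 0 by apply: contraTneq sz => e; rewrite -leqNgt maxnC cst // coprimep_sym.
have inf : infinitely (fun x : R[i] => logd P x = logd Q x).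
  move=> s; pose f (n : nat) : R[i] := n%:R.
  have finj : injective f by move=> m n /eqP; rewrite eqr_nat => /eqP.
  have infT : infinitely (fun x : R[i] => True).
    by move=> s'; have [n hn] := injective_avoid s' finj; exists (f n).
  have [x xs [pq _]] := infinitely_nonroot infT (mulf_neq0 P0 Q0) s; exists x => //.
  move: pq; rewrite hornerM mulf_eq0 negb_or => /andP[px qx].
  apply/eqP; rewrite -subr_eq0 (logd_quot px qx).1 /quot1 W0 horner0.
  by rewrite !mul0r.
have [k k0 PE] := logd_eq P0 Q0 inf.
move: co sz; rewrite PE coprimepZl // coprimepp size_scale // maxnn => /eqP ->.
by [].
Qed.

End PullbackOde.

(** * The theorem *)

(** Serves to read exponent differences, known up to order, as sixths of natural
numbers. *)
Lemma perm_map_inv (T S : eqType) (x0 : T) (f : T -> S) (s : seq T) (t : seq S) :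
  uniq (map f s) -> perm_eq t (map f s) -> exists2 s', perm_eq s' s & t = map f s'.
Proof.
move=> un pt; pose g y := nth x0 s (index y (map f s)).
have fg y : y \in t -> f (g y) = y.
  rewrite (perm_mem pt) => ys; rewrite /g -(nth_map _ (f x0)) ?nth_index //.
  by rewrite -(size_map f) index_mem.
exists (map g t); last by rewrite -map_comp -[LHS]map_id; apply/eq_in_map => y /fg.
apply: (perm_trans (perm_map g pt)); rewrite -map_comp.
suff -> : map (g \o f) s = s by [].
rewrite -[RHS]map_id; apply/eq_in_map => y ys /=; rewrite /g -{1}(nth_index x0 ys).
rewrite -(nth_map _ (f x0)) ?index_mem // index_uniq ?size_map ?index_mem //.
by rewrite nth_index.
Qed.

Section Final.
Variable R : realType.

Lemma exp_diffs_236 (E : hypergeom R) : has_exp_diffs E [:: 1 / 2; 1 / 3; 1 / 6] ->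
  exists m0 m1 m2 : nat, perm_eq [:: m0; m1; m2] [:: 3; 2; 1]%N /\
    [/\ (1 - parC E == m0%:R / 6) || (1 - parC E == - (m0%:R / 6)),
        (parC E - parA E - parB E == m1%:R / 6) || (parC E - parA E - parB E == - (m1%:R / 6)) &
        (parA E - parB E == m2%:R / 6) || (parA E - parB E == - (m2%:R / 6))].
Proof.
move=> [t pt]; pose f (m : nat) : R[i] := m%:R / 6.
have s6 : (6 : R[i]) != 0 by rewrite pnatr_eq0.
have sE : [:: 1 / 2; 1 / 3; 1 / 6] = map f [:: 3; 2; 1]%N.
  rewrite /f /=; have -> : 1 / 2 = 3%:R / 6 :> R[i] by field.
  by have -> : 1 / 3 = 2%:R / 6 :> R[i] by field.
have finj : injective f.
  by move=> m n /(mulIf (invr_neq0 s6)) /eqP; rewrite eqr_nat => /eqP.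
rewrite sE in pt; have [|s' ps' ->] := perm_map_inv 0%N _ pt; first by rewrite map_inj_uniq.
have := perm_size ps'; case: s' ps' => [|m0 [|m1 [|m2 []]]] //= ps' _.
by move=> /and4P[h0 h1 h2 _]; exists m0, m1, m2.
Qed.

Lemma exp_diffs_333 (E : hypergeom R) : has_exp_diffs E [:: 1 / 3; 1 / 3; 1 / 3] ->
  [/\ (1 - parC E == 1 / 3) || (1 - parC E == - (1 / 3)),
      (parC E - parA E - parB E == 1 / 3) || (parC E - parA E - parB E == - (1 / 3)) &
      (parA E - parB E == 1 / 3) || (parA E - parB E == - (1 / 3))].
Proof.
move=> [t pt]; have al x : x \in t -> x = 1 / 3.
  by rewrite (perm_mem pt) !inE !orbb => /eqP.
have := perm_size pt; case: t pt al => [|m0 [|m1 [|m2 []]]] //= _ al _.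
have e0 : m0 = 1 / 3 by apply: al; rewrite mem_head.
have e1 : m1 = 1 / 3 by apply: al; rewrite inE mem_head orbT.
have e2 : m2 = 1 / 3 by apply: al; rewrite !inE eqxx !orbT.
by rewrite e0 e1 e2 => /and4P[h0 h1 h2 _]; split.
Qed.

(** The excluded points are the zeros and poles of the bases of [theta] and the
points of the exceptional fibres or with [x = 0, 1]; they are finite in number. *)
Lemma pullback_infinitely (E E' : hypergeom R) (phi : ratfun R) (theta : radical R) :
  pullback E E' phi theta -> (1 < maxn (size (rnum phi)) (size (rden phi)))%N ->
  2^-1 <= complex.Re (parC E) -> complex.Re (parC E) <= 3 / 2 -> parC E != 1 ->
  infinitely (pullback_ode (parA E) (parB E) (parC E) (parA E') (parB E') (parC E')
    (rnum phi) (rden phi) (theta_log theta) (theta_dlog theta)).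
Proof.
move=> pb sz c1 c2 c3.
set P := rnum phi in sz *; set Q := rden phi in sz *.
have co : coprimep P Q := rnum_rden_coprime phi.
have W0 := wronsk_neq0 co sz.
have P0 : P != 0 by apply: contraNneq W0 => ->; rewrite /wronsk raddf0 !mul0r subr0.
have QP0 : Q - P != 0.
  by apply: contraNneq W0 => /eqP; rewrite subr_eq0 => /eqP ->; rewrite /wronsk mulrC subrr.
have [r r0 [ya [yb [sa sb wr]]]] := fundamental_pair c1 c2 c3.
pose n := rad_size theta.
pose bad : {poly R[i]} := (\prod_(i < n) (rnum (rad_base theta i) * rden (rad_base theta i)))
   * ((P * (Q - P)) * ('X * (1 - 'X))).
have bad0 : bad != 0.
  rewrite mulf_neq0 //; first by apply/prodf_neq0 => i _; rewrite mulf_neq0 ?rden_neq0 ?rad_base_neq0.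
  rewrite mulf_neq0 ?mulf_neq0 ?polyX_eq0 //.
  by rewrite -opprB oppr_eq0 -[1]/(1%:P) polyXsubC_eq0.
have inf := infinitely_nonroot (infinitely_preimage co sz r0) bad0.
move=> s; have [x xs [bx [qx Vx]]] := inf s; exists x => //.
move: bx; rewrite /bad !hornerM !mulf_eq0 !negb_or horner_prod => /and3P[tx /andP[px qpx] /andP[x0 x1]].
apply: (pullback_ode_at pb sa sb wr) => //.
- move=> i; move/prodf_neq0: tx => /(_ i isT); rewrite hornerM mulf_eq0 negb_or.
  by move=> /andP[].
- by rewrite hornerX in x0.
- by rewrite !hornerE in x1.
- by rewrite /reval mulf_neq0 // invr_neq0.
have [e _ _] := quot_compl P qx.
by rewrite -[reval _ _]/(quot P Q x) -e /quot mulf_neq0 // invr_neq0.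
Qed.

End Final.

Theorem mainTheorem8 (R : realType) (n : nat) :
  ~ exists (E E' : hypergeom R) (phi : ratfun R) (theta : radical R),
      [/\ has_exp_diffs E [:: 1 / 2; 1 / 3; 1 / 6],
          has_exp_diffs E' [:: 1 / 3; 1 / 3; 1 / 3],
          rdeg phi = (6 * n + 4)%N &
          pullback E E' phi theta].
Proof.
move=> [E [E' [phi [theta [hE hE' deg pb]]]]].
have [m0 [m1 [m2 [pm [h0 h1 h2]]]]] := exp_diffs_236 hE.
have [h0' h1' h2'] := exp_diffs_333 hE'.
have sz : maxn (size (rnum phi)) (size (rden phi)) = (6 * n + 5)%N.
  by move: deg; rewrite /rdeg; move: (maxn _ _) => k; clear; lia.
have sz1 : (1 < maxn (size (rnum phi)) (size (rden phi)))%N by rewrite sz addnC.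
have sum6 : (m0 + m1 + m2 = 6)%N by have := perm_sumn pm; rewrite /= addn0 addnA.
have m06 : (0 < m0 <= 3)%N.
  have : m0 \in [:: 3; 2; 1]%N by rewrite -(perm_mem pm) inE eqxx.
  by rewrite !inE => /or3P[] /eqP ->.
have m16 : (m1 <= 6)%N by rewrite -sum6 -addnA addnCA leq_addr.
have nz6 : (6 : R[i]) != 0 by rewrite pnatr_eq0.
have [al [be el]] : exists al be, elementary (parA E) (parB E) (parC E) (m0%:R / 6) (m1%:R / 6) al be.
  apply: elementary_exists h0 h1 h2; rewrite -!mulrDl -!natrD sum6 divff //.
have [al' [be' el']] : exists al be, elementary (parA E') (parB E') (parC E') (1 / 3) (1 / 3) al be.
  by apply: elementary_exists h0' h1' h2'; field.
have [c1 c2 c3] : [/\ 2^-1 <= complex.Re (parC E), complex.Re (parC E) <= 3 / 2 & parC E != 1].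
  have e0 : m0%:R / 6 = (m0%:R / 6)%:C%C :> R[i] by rewrite rmorphM fmorphV !rmorph_nat.
  have b1 : 0 < m0%:R / 6 :> R by case/andP: m06 => k _; rewrite divr_gt0 // ltr0n.
  have b2 : m0%:R / 6 <= 2^-1 :> R.
    case/andP: m06 => _ k; have : m0%:R <= 3 :> R by rewrite (ler_nat _ _ 3).
    lra.
  have reE : complex.Re (1 - parC E) = 1 - complex.Re (parC E) by rewrite raddfB.
  have c12 : complex.Re (parC E) = 1 - m0%:R / 6 \/ complex.Re (parC E) = 1 + m0%:R / 6.
    case/orP: h0 => /eqP h; [left|right]; move: reE; rewrite h e0 ?raddfN /=.
      by move=> e; rewrite -[LHS](subKr 1) -e.
    by move=> e; rewrite -[LHS](subKr 1) -e opprK.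
  move: (m0%:R / 6 : R) b1 b2 c12 => q b1 b2 c12; split.
  - by case: c12 => ->; clear -b1 b2; lra.
  - by case: c12 => ->; clear -b1 b2; lra.
  by apply/eqP => c1; move: c12; rewrite c1 /=; clear -b1 b2; case=> ?; lra.
have W0 := wronsk_neq0 (rnum_rden_coprime phi) sz1.
have h6 m : 6 * (m%:R / 6) = m%:R :> R[i] by rewrite mulrC divfK.
have m06' : (m0 <= 6)%N by case/andP: m06 => _ k; rewrite (leq_trans k).
have [k k0 K] := covering_identity el el' (h6 m0) (h6 m1) m06' m16 W0 (theta_ratpair theta)
  (pullback_infinitely pb sz1 c1 c2 c3).
exact: (no_covering_any_order (rnum_rden_coprime phi) sz W0 pm k0 K).
Qed.
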